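(* Assume Hypotheses 1, 2 and 3 (stated in the context). Let $K := \Pi_\perp(\Gamma) = \Pi_\perp(U)$. Then $\Gamma$ contains every subset of $U$ that is positively invariant under the flow of the system, and there exists a $C^1$ function $h : K \to \mathbb{R}^n$ such that $\Gamma = \{(h(z), z) : z \in K\}$. Moreover, $\|h(z_2) - h(z_1)\| < \|z_2 - z_1\|$ for all $z_1, z_2 \in K$ with $z_1 \neq z_2$, and $\|Dh(z)\| < 1$ for all $z \in K$.
   Context: Consider the system $\dot a = f(a,z)$, $\dot z = g(a,z)$ with $(a,z)\in\mathbb{R}^n\times\mathbb{R}^m$; write $x=(a,z)$, $X=\mathbb{R}^n\times\mathbb{R}^m$. $\langle\cdot,\cdot\rangle$ and $\|\cdot\|$ are the Euclidean inner product and norm (and induced operator norm). $\Phi(t,x)$ denotes the (local) flow of the system on its domain. A set $\Gamma\subseteq U$ is positively invariant if for every $x\in\Gamma$, $\Phi(t,x)$ is defined for all $t\ge0$ and $\Phi(t,\Gamma)\subseteq\Gamma$ for all $t\ge 0$. Projections: $\Pi(a,z)=a$, $\Pi_\perp(a,z)=z$. For $x=(a,z)$ and $d>0$, $\mathbb{B}_d(x)=\{(a',z'): \|a'-a\|\le d,\ \|z'-z\|\le d\}$. Define $\mathcal{L}(x_1,x_2)=\|a_2-a_1\|^2-\|z_2-z_1\|^2$ for $x_i=(a_i,z_i)$, and the cone $\mathcal{C}(x)=\{x'\in X:\mathcal{L}(x',x)\ge 0\}$. Hypothesis 1: $U$ is an open, convex subset of $\mathbb{R}^n\times\mathbb{R}^m$,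 and there exists $d>0$ such that $\mathcal{C}(x)\cap U\subset\mathbb{B}_d(x)$ for all $x\in U$. Hypothesis 2: $f,g$ are $C^1$ on $U$, and there exist a continuous positive function $\alpha:U\to\mathbb{R}$, a continuous nonnegative function $\ell:U\to\mathbb{R}$ and a constant $c_1>0$ such that for all $x\in U$: $\langle a', D_af(x)a'\rangle\ge\alpha(x)\|a'\|^2$ for all $a'\in\mathbb{R}^n$; $\langle z', D_zg(x)z'\rangle\le\ell(x)\|z'\|^2$ for all $z'\in\mathbb{R}^m$; and $\alpha(x)\ge \ell(x)+\|D_zf(x)\|+\|D_ag(x)\|+c_1$. Hypothesis 3: $\Gamma\subset U$ is positively invariant under the flow and $\Pi_\perp(\Gamma)=\Pi_\perp(U)$. *)

(* Defs.v *)
From Stdlib Require Import Reals ClassicalEpsilon.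
From mathcomp Require Import ssreflect ssrfun ssrbool eqtype ssrnat seq fintype bigop.

Set Implicit Arguments.
Unset Strict Implicit.

Local Open Scope R_scope.

Definition vec (n : nat) := 'I_n -> R.
Definition mat (q p : nat) := 'I_q -> 'I_p -> R.

Definition vadd n (u v : vec n) : vec n := fun i => u i + v i.
Definition vsub n (u v : vec n) : vec n := fun i => u i - v i.

Definition dot n (u v : vec n) : R := \big[Rplus/0]_(i < n) (u i * v i).
Definition vnorm n (u : vec n) : R := sqrt (dot u u).

Definition mapply q p (A : mat q p) (v : vec p) : vec q :=
  fun i => \big[Rplus/0]_(j < p) (A i j * v j).

Definition opnorm_set q p (A : mat q p) : R -> Prop :=
  fun r => exists v : vec p, vnorm v <= 1 /\ r = vnorm (mapply A v).
Definition opnorm q p (A : mat q p) : R :=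
  epsilon (inhabits 0) (fun c => is_lub (opnorm_set A) c).

Definition X (n m : nat) := (vec n * vec m)%type.
Definition Xnorm n m (x : X n m) : R := sqrt (dot x.1 x.1 + dot x.2 x.2).
Definition Xsub n m (x y : X n m) : X n m := (vsub x.1 y.1, vsub x.2 y.2).

Definition openX n m (U : X n m -> Prop) : Prop :=
  forall x, U x -> exists r, 0 < r /\ forall y, Xnorm (Xsub y x) < r -> U y.
Definition convexX n m (U : X n m -> Prop) : Prop :=
  forall x y (t : R), U x -> U y -> 0 <= t <= 1 ->
    U ((fun i => (1 - t) * x.1 i + t * y.1 i), (fun j => (1 - t) * x.2 j + t * y.2 j)).

Definition Lf n m (x1 x2 : X n m) : R :=
  vnorm (vsub x2.1 x1.1) ^ 2 - vnorm (vsub x2.2 x1.2) ^ 2.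
Definition cone n m (x : X n m) : X n m -> Prop := fun x' => 0 <= Lf x' x.
Definition boxB n m (d : R) (x : X n m) : X n m -> Prop :=
  fun x' => vnorm (vsub x'.1 x.1) <= d /\ vnorm (vsub x'.2 x.2) <= d.

Definition Pi n m (x : X n m) : vec n := x.1.
Definition Piperp n m (x : X n m) : vec m := x.2.

Definition frechetX n m q (F : X n m -> vec q) (x : X n m)
    (La : mat q n) (Lz : mat q m) : Prop :=
  forall eps, 0 < eps -> exists delta, 0 < delta /\
    forall y, Xnorm (Xsub y x) < delta ->
      vnorm (fun i => F y i - F x i - mapply La (vsub y.1 x.1) i
                      - mapply Lz (vsub y.2 x.2) i)
        <= eps * Xnorm (Xsub y x).

Definition frechet m q (h : vec m -> vec q) (z : vec m) (A : mat q m) : Prop :=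
  forall eps, 0 < eps -> exists delta, 0 < delta /\
    forall w, vnorm (vsub w z) < delta ->
      vnorm (fun i => h w i - h z i - mapply A (vsub w z) i)
        <= eps * vnorm (vsub w z).

Definition contX_on n m (S : X n m -> Prop) (phi : X n m -> R) : Prop :=
  forall x, S x -> forall eps, 0 < eps -> exists delta, 0 < delta /\
    forall y, S y -> Xnorm (Xsub y x) < delta -> Rabs (phi y - phi x) < eps.
Definition mat_contX_on n m q p (S : X n m -> Prop) (M : X n m -> mat q p) : Prop :=
  forall i j, contX_on S (fun x => M x i j).
Definition mat_cont_on m q p (S : vec m -> Prop) (M : vec m -> mat q p) : Prop :=
  forall i j, forall z, S z -> forall eps, 0 < eps -> exists delta, 0 < delta /\
    forall w, S w -> vnorm (vsub w z) < delta -> Rabs (M w i j - M z i j) < eps.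

Definition C1X_on n m q (U : X n m -> Prop) (F : X n m -> vec q)
    (DaF : X n m -> mat q n) (DzF : X n m -> mat q m) : Prop :=
  (forall x, U x -> frechetX F x (DaF x) (DzF x)) /\
  mat_contX_on U DaF /\ mat_contX_on U DzF.

Definition C1_on m q (K : vec m -> Prop) (h : vec m -> vec q) (Dh : vec m -> mat q m) : Prop :=
  (forall z, K z -> frechet h z (Dh z)) /\ mat_cont_on K Dh.

Definition forward_solution n m (f : X n m -> vec n) (g : X n m -> vec m)
    (phi : R -> X n m) : Prop :=
  forall t, 0 <= t ->
    (forall i, derivable_pt_lim (fun s => (phi s).1 i) t (f (phi t) i)) /\
    (forall j, derivable_pt_lim (fun s => (phi s).2 j) t (g (phi t) j)).

(* Positive invariance of Gamma under the (local) flow of the system on U: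
   for each x in Gamma the flow Phi(t,x) is defined (as a solution in U)
   for all t >= 0 and stays in Gamma.  (Solutions in U are unique since
   f, g are C^1 on U, so this trajectory is Phi(., x).) *)
Definition pos_invariant n m (f : X n m -> vec n) (g : X n m -> vec m)
    (U Gamma : X n m -> Prop) : Prop :=
  (forall x, Gamma x -> U x) /\
  forall x, Gamma x -> exists phi : R -> X n m,
    phi 0 = x /\ forward_solution f g phi /\
    (forall t, 0 <= t -> U (phi t)) /\
    (forall t, 0 <= t -> Gamma (phi t)).

(* Main.v *)
(* If two distinct points with global solutions in U satisfy |a2 - a1| >= |z2 - z1|, the
   hypotheses force |a2 - a1|^2 to grow without bound inside the cone, against Hypothesis 1.
   Hence distinct points of Gamma and of any positively invariant set satisfy
   |a2 - a1| < |z2 - z1|, and Gamma is the graph of a contraction h, whatever the uniqueness of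
   solutions.

   For the smoothness, take two pairs of points of Gamma close to (h z, z) whose z-components
   differ by multiples of one vector v.  Over a finite time T their rescaled differences follow
   the linearization along one trajectory up to a small error and remain outside the cone, so
   they grow at most like the z-directions.  Their difference starts in the cone (its z-component
   vanishes), so if it were not small its a-component would grow faster by a factor exp (c1 T / 4),
   which is absurd for T large.  So the difference quotients of h in each coordinate direction
   are Cauchy, uniformly near z: h is strictly differentiable at every z, which gives C^1.
   A similar comparison along one trajectory, with a slightly wider cone closing up to the
   original one at time 1, bounds the local Lipschitz constant away from 1. *)
From HB Require Import structures.
Require Import Defs.
From Stdlib Require Import Reals Lra Psatz ClassicalEpsilon FunctionalExtensionality.
From Coquelicot Require Coquelicot.
From mathcomp Require Import ssreflect ssrfun ssrbool eqtype ssrnat seq fintype bigop.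

Set Implicit Arguments.
Unset Strict Implicit.

Local Open Scope R_scope.

(** * Euclidean vectors and matrices *)

Lemma RplusA : associative Rplus. Proof. by move=> x y z; ring. Qed.
Lemma RplusC : commutative Rplus. Proof. by move=> x y; ring. Qed.
Lemma Rplus0l : left_id 0 Rplus. Proof. by move=> x; ring. Qed.
HB.instance Definition _ := Monoid.isComLaw.Build R 0 Rplus RplusA RplusC Rplus0l.

Lemma sumrM k (I : Type) (r : seq I) (F : I -> R) :
  \big[Rplus/0]_(i <- r) (k * F i) = k * \big[Rplus/0]_(i <- r) F i.
Proof. by elim: r => [|i r IH]; rewrite ?big_nil ?big_cons ?IH; ring. Qed.

Lemma sumr_le (I : Type) (r : seq I) (F G : I -> R) :
  (forall i, F i <= G i) -> \big[Rplus/0]_(i <- r) F i <= \big[Rplus/0]_(i <- r) G i.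
Proof.
by move=> H; elim: r => [|i r IH]; rewrite ?big_nil ?big_cons; [lra | have := H i; lra].
Qed.

Lemma sumr_ge0 (I : Type) (r : seq I) (F : I -> R) :
  (forall i, 0 <= F i) -> 0 <= \big[Rplus/0]_(i <- r) F i.
Proof.
by move=> H; elim: r => [|i r IH]; rewrite ?big_nil ?big_cons; [lra | have := H i; lra].
Qed.

Lemma sumr_const k (c : R) : \big[Rplus/0]_(j < k) c = INR k * c.
Proof.
elim: k => [|k IH]; first by rewrite big_ord0 /=; ring.
by rewrite S_INR big_ord_recr /= IH; ring.
Qed.

Definition vscal n (k : R) (u : vec n) : vec n := fun i => k * u i.

Ltac vext := apply: functional_extensionality => ?; rewrite /vadd /vsub /vscal /=; try ring.

Section Vectors.
Variable n : nat.
Implicit Types u v w : vec n.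

Lemma dotC u v : dot u v = dot v u.
Proof. by apply: eq_bigr => i _; ring. Qed.

Lemma dotDl u v w : dot (vadd u v) w = dot u w + dot v w.
Proof. by rewrite /dot -big_split /=; apply: eq_bigr => i _; rewrite /vadd; ring. Qed.

Lemma dotZl k u v : dot (vscal k u) v = k * dot u v.
Proof. by rewrite /dot -sumrM; apply: eq_bigr => i _; rewrite /vscal; ring. Qed.

Lemma dotDr u v w : dot w (vadd u v) = dot w u + dot w v.
Proof. by rewrite dotC dotDl !(dotC w). Qed.

Lemma dotZr k u v : dot u (vscal k v) = k * dot u v.
Proof. by rewrite dotC dotZl dotC. Qed.

Lemma vsubE u v : vsub u v = vadd u (vscal (-1) v).
Proof. by vext. Qed.

Lemma dotBl u v w : dot (vsub u v) w = dot u w - dot v w.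
Proof. by rewrite vsubE dotDl dotZl; ring. Qed.

Lemma dotBr u v w : dot w (vsub u v) = dot w u - dot w v.
Proof. by rewrite dotC dotBl !(dotC w). Qed.

Lemma dot_ge0 u : 0 <= dot u u.
Proof. by apply: sumr_ge0 => i; nra. Qed.

Lemma vnorm_ge0 u : 0 <= vnorm u. Proof. exact: sqrt_pos. Qed.

Lemma vnorm2 u : vnorm u ^ 2 = dot u u.
Proof. by rewrite /vnorm pow2_sqrt //; exact: dot_ge0. Qed.

Lemma vnorm_le u r : 0 <= r -> dot u u <= r ^ 2 -> vnorm u <= r.
Proof.
move=> r0 H; rewrite /vnorm -(sqrt_pow2 r) //.
by apply: sqrt_le_1_alt.
Qed.

Lemma vnorm_lt u r : 0 < r -> dot u u < r ^ 2 -> vnorm u < r.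
Proof.
move=> r0 H; rewrite /vnorm -(sqrt_pow2 r); last lra.
by apply: sqrt_lt_1_alt; split => //; exact: dot_ge0.
Qed.

(** Division by [vnorm u]. This allows a norm bound to be proved by testing a vector against
    itself. *)
Lemma vnorm_le_of_dot u r : 0 <= r -> dot u u <= r * vnorm u -> vnorm u <= r.
Proof.
rewrite -vnorm2 => r0 H; have [u0|u0] := vnorm_ge0 u; last by lra.
by apply: (Rmult_le_reg_r (vnorm u)) => //; lra.
Qed.

Lemma coord_le_vnorm u i : Rabs (u i) <= vnorm u.
Proof.
rewrite -sqrt_Rsqr_abs /vnorm; apply: sqrt_le_1_alt.
rewrite /dot (bigD1 i) //= /Rsqr.
suff H : 0 <= \big[Rplus/0]_(j < n | j != i) (u j * u j).
  by move: H; set s := \big[_/_]_(_ < _ | _) _ => H; lra.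
by rewrite big_mkcond; apply: sumr_ge0 => j; case: ifP => _; nra.
Qed.

Lemma vnorm_eq0 u : vnorm u = 0 -> u = fun=> 0.
Proof.
move=> H; apply: functional_extensionality => i.
have := coord_le_vnorm u i; rewrite H.
by have := Rle_abs (u i); have := Rle_abs (- u i); rewrite Rabs_Ropp; lra.
Qed.

Lemma vsub_eq0 u v : vnorm (vsub u v) = 0 -> u = v.
Proof.
move=> /vnorm_eq0 H; apply: functional_extensionality => i.
by have := f_equal (fun w => w i) H; rewrite /vsub /=; lra.
Qed.

Lemma dot_le u v : dot u v <= vnorm u * vnorm v.
Proof.
have Hu := vnorm_ge0 u; have Hv := vnorm_ge0 v.
have [v0|v0] : vnorm v = 0 \/ 0 < vnorm v by lra.
  rewrite v0 (vnorm_eq0 v0).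
  rewrite /dot (eq_bigr (fun=> 0 * 0)) ?sumrM; first lra.
  by move=> i _; ring.
have [u0|u0] : vnorm u = 0 \/ 0 < vnorm u by lra.
  rewrite u0 (vnorm_eq0 u0).
  rewrite /dot (eq_bigr (fun=> 0 * 0)) ?sumrM; first lra.
  by move=> i _; ring.
(* Cauchy-Schwarz: this square equals [2 * (vnorm u * vnorm v) * (vnorm u * vnorm v - dot u v)]. *)
have := dot_ge0 (vsub (vscal (vnorm v) u) (vscal (vnorm u) v)).
rewrite !dotBl !dotBr !dotZl !dotZr -!vnorm2 (dotC v u) => H.
have P : 0 < vnorm u * vnorm v by nra.
have : 0 <= 2 * (vnorm u * vnorm v) * (vnorm u * vnorm v - dot u v) by nra.
by nra.
Qed.

Lemma vnormZ k u : vnorm (vscal k u) = Rabs k * vnorm u.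
Proof.
rewrite /vnorm dotZl dotZr -sqrt_Rsqr_abs -sqrt_mult_alt; last exact: Rle_0_sqr.
by congr sqrt; rewrite /Rsqr; ring.
Qed.

Lemma vnorm_add u v : vnorm (vadd u v) <= vnorm u + vnorm v.
Proof.
have Hu := vnorm_ge0 u; have Hv := vnorm_ge0 v.
apply: vnorm_le; first lra.
rewrite dotDl !dotDr -!vnorm2 (dotC v u).
by have := dot_le u v; nra.
Qed.

Lemma vnorm_subC u v : vnorm (vsub u v) = vnorm (vsub v u).
Proof.
have -> : vsub u v = vscal (-1) (vsub v u) by vext.
by rewrite vnormZ Rabs_Ropp Rabs_R1; ring.
Qed.

Lemma vnorm_sub u v : vnorm (vsub u v) <= vnorm u + vnorm v.
Proof.
have -> : vsub u v = vadd u (vscal (-1) v) by vext.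
apply: Rle_trans (vnorm_add _ _) _.
by rewrite vnormZ Rabs_Ropp Rabs_R1; lra.
Qed.

Lemma vnorm_sub_tri u v w : vnorm (vsub u w) <= vnorm (vsub u v) + vnorm (vsub v w).
Proof.
have -> : vsub u w = vadd (vsub u v) (vsub v w) by vext.
exact: vnorm_add.
Qed.

Lemma vnorm_subvv u : vnorm (vsub u u) = 0.
Proof.
have -> : vsub u u = vscal 0 u by vext.
by rewrite vnormZ Rabs_R0; ring.
Qed.

Lemma dot_ge u v : - (vnorm u * vnorm v) <= dot u v.
Proof.
have := dot_le (vscal (-1) u) v.
by rewrite dotZl vnormZ Rabs_Ropp Rabs_R1; lra.
Qed.

Lemma vnorm_le_coord u (r : R) : 0 <= r -> (forall i, Rabs (u i) <= r) -> vnorm u <= INR n * r.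
Proof.
move=> r0 H; have n0 := pos_INR n.
have dn : dot u u <= INR n * r ^ 2.
  rewrite -sumr_const.
  apply: sumr_le => i; have := H i; have := Rabs_pos (u i).
  by have := Rsqr_abs (u i); rewrite /Rsqr; nra.
(* The comparison of [n * r ^ 2] with [(n * r) ^ 2] needs [n <= n ^ 2], hence a dimension that is
   zero or at least one. *)
have [N0|N1] : INR n = 0 \/ 1 <= INR n.
  by case: (n) => [|k]; [left | right; rewrite S_INR; have := pos_INR k; lra].
  by apply: vnorm_le; rewrite N0 in dn *; nra.
apply: vnorm_le; first nra.
have := Rle_0_sqr r; rewrite /Rsqr => ?.
suff : INR n * r ^ 2 <= INR n * (INR n * r ^ 2) by nra.
by apply: Rmult_le_compat_l => //; nra.
Qed.

End Vectors.

Section Matrices.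
Variables q p : nat.
Implicit Types (A B : mat q p) (u v : vec p).

Lemma mapplyD A u v : mapply A (vadd u v) = vadd (mapply A u) (mapply A v).
Proof.
apply: functional_extensionality => i; rewrite /mapply /vadd -big_split /=.
by apply: eq_bigr => j _; ring.
Qed.

Lemma mapplyZ A k v : mapply A (vscal k v) = vscal k (mapply A v).
Proof.
apply: functional_extensionality => i; rewrite /mapply /vscal -sumrM.
by apply: eq_bigr => j _; ring.
Qed.

Lemma mapplyB A u v : mapply A (vsub u v) = vsub (mapply A u) (mapply A v).
Proof. by rewrite !vsubE mapplyD mapplyZ. Qed.

(** A crude bound whose constant is immaterial: it makes the operator norm finite and turns
    entrywise continuity into continuity of operators. *)
Lemma bilinear_le A r (w : vec q) v : 0 <= r ->
  (forall i j, Rabs (A i j) <= r) ->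
  dot w (mapply A v) <= INR q * INR p * r * vnorm w * vnorm v.
Proof.
move=> r0 H.
have p0 := pos_INR p; have q0 := pos_INR q.
have v0 := vnorm_ge0 v; have w0 := vnorm_ge0 w.
have rv i : Rabs (mapply A v i) <= INR p * (r * vnorm v).
  rewrite -sumr_const /mapply.
  apply: Rle_trans (_ : \big[Rplus/0]_(j < p) Rabs (A i j * v j) <= _).
    elim: (index_enum _) => [|j s IH]; rewrite ?big_nil ?big_cons ?Rabs_R0; first lra.
    apply: Rle_trans (Rabs_triang _ _) _; move: IH => /=; lra.
  apply: sumr_le => j; rewrite Rabs_mult.
  have := H i j; have := coord_le_vnorm v j.
  by have := Rabs_pos (A i j); have := Rabs_pos (v j); nra.
have rv0 : 0 <= r * vnorm v by nra.
apply: Rle_trans (dot_le _ _) _.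
have := vnorm_le_coord _ rv.
by nra.
Qed.

(** [opnorm] is a choice and means something only once a least upper bound exists. The set is
    bounded by [bilinear_le] tested with [mapply A v] itself, and the zero vector makes it
    nonempty. *)
Lemma opnorm_lub A : is_lub (opnorm_set A) (opnorm A).
Proof.
apply: epsilon_spec.
have [r [r0 Hr]] : exists r, 0 <= r /\ forall i j, Rabs (A i j) <= r.
  exists (\big[Rplus/0]_(i < q) \big[Rplus/0]_(j < p) Rabs (A i j)); split.
    by apply: sumr_ge0 => i; apply: sumr_ge0 => j; exact: Rabs_pos.
  move=> i j; rewrite (bigD1 i) //= (bigD1 j) //=.
  set s := (X in _ <= _ + X + _); set t := (X in _ <= _ + _ + X).
  have ? : 0 <= s.
    by rewrite /s big_mkcond; apply: sumr_ge0 => k; case: ifP => _; [exact: Rabs_pos | lra].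
  have ? : 0 <= t.
    rewrite /t big_mkcond; apply: sumr_ge0 => k; case: ifP => _; last lra.
    by apply: sumr_ge0 => l; exact: Rabs_pos.
  by lra.
have [||c Hc] := completeness (opnorm_set A); last by exists c.
- exists (INR q * INR p * r) => _ [v [Hv ->]].
  have := bilinear_le (mapply A v) v r0 Hr; rewrite -vnorm2.
  have := vnorm_ge0 (mapply A v); have := vnorm_ge0 v.
  have p0 := pos_INR p; have q0 := pos_INR q.
  have : 0 <= INR q * INR p * r by apply: Rmult_le_pos => //; nra.
  set C := INR q * INR p * r; set a := vnorm (mapply A v); set b := vnorm v => ? ? ? ?.
  have [->//|a0] : a = 0 \/ 0 < a by lra.
  suff : a <= C * b by move: Hv; rewrite -/b; nra.
  by apply: (Rmult_le_reg_l a) => //; lra.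
- exists (vnorm (mapply A (fun=> 0))); exists (fun=> 0); split=> //.
  by apply: vnorm_le; [lra | rewrite /dot (eq_bigr (fun=> 0 * 0)) ?sumrM //; lra].
Qed.

Lemma opnorm_ge0 A : 0 <= opnorm A.
Proof.
have [ub _] := opnorm_lub A.
apply: Rle_trans (vnorm_ge0 (mapply A (fun=> 0))) _.
apply: ub; exists (fun=> 0); split=> //.
by apply: vnorm_le; [lra | rewrite /dot (eq_bigr (fun=> 0 * 0)) ?sumrM //; lra].
Qed.

Lemma vnorm_mapply A v : vnorm (mapply A v) <= opnorm A * vnorm v.
Proof.
have [ub _] := opnorm_lub A.
have := vnorm_ge0 v; case=> [v0|v0]; last first.
  rewrite -v0 (_ : mapply A v = vscal 0 (mapply A v)); first by rewrite vnormZ Rabs_R0; lra.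
  rewrite -mapplyZ (_ : vscal 0 v = v) //.
  by rewrite (vnorm_eq0 (esym v0)); vext.
have : vnorm (mapply A (vscal (/ vnorm v) v)) <= opnorm A.
  apply: ub; eexists; split; last by [].
  rewrite vnormZ Rabs_pos_eq; first by rewrite Rinv_l; lra.
  by apply: Rlt_le; exact: Rinv_0_lt_compat.
rewrite mapplyZ vnormZ Rabs_pos_eq; last by apply: Rlt_le; exact: Rinv_0_lt_compat.
move=> H; apply: (Rmult_le_reg_l (/ vnorm v)); first exact: Rinv_0_lt_compat.
by apply: Rle_trans H _; apply: Req_le; field; lra.
Qed.

Lemma opnorm_le A r : 0 <= r -> (forall v, vnorm (mapply A v) <= r * vnorm v) -> opnorm A <= r.
Proof.
move=> r0 H; have [_ lub] := opnorm_lub A.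
by apply: lub => _ [v [Hv ->]]; have := H v; have := vnorm_ge0 v; nra.
Qed.

Lemma dot_mapply_le A (w : vec q) v : dot w (mapply A v) <= opnorm A * vnorm w * vnorm v.
Proof.
have := dot_le w (mapply A v); have := vnorm_mapply A v; have := vnorm_ge0 w; nra.
Qed.

Lemma dot_mapply_ge A (w : vec q) v : - (opnorm A * vnorm w * vnorm v) <= dot w (mapply A v).
Proof.
have := dot_ge w (mapply A v); have := vnorm_mapply A v; have := vnorm_ge0 w; nra.
Qed.
End Matrices.

(** * Common radii and closeness of matrices *)

(** Finitely many positive radii have a positive minimum, and [P] survives shrinking the radius. *)
Lemma finite_radius k (P : 'I_k -> R -> Prop) :
  (forall i r r', 0 < r' <= r -> P i r -> P i r') ->
  (forall i, exists r, 0 < r /\ P i r) -> exists r, 0 < r /\ forall i, P i r.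
Proof.
move=> mono ex.
suff H (s : seq 'I_k) : exists r, 0 < r /\ forall i, i \in s -> P i r.
  have [r [r0 Hr]] := H (enum 'I_k); exists r; split=> // i.
  by apply: Hr; rewrite mem_enum.
elim: s => [|i s [r [r0 IH]]]; first by exists 1; split; [lra|].
have [r' [r'0 Hi]] := ex i.
have m1 := Rmin_l r r'; have m2 := Rmin_r r r'; have m0 := Rmin_pos _ _ r0 r'0.
exists (Rmin r r'); split=> // j; rewrite inE => /orP [/eqP ->|js].
  exact: mono Hi.
by apply: mono (IH _ js).
Qed.

(** Distance at most [w] in operator norm, in bilinear form so that it combines directly with the
    scalar mean value theorem. One inequality is enough, since [e] may change sign. *)
Definition op_close q p (A B : mat q p) (w : R) :=
  forall (e : vec q) (v : vec p),
    dot e (mapply A v) - dot e (mapply B v) <= w * vnorm e * vnorm v.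

Lemma op_close_sym q p (A B : mat q p) w : op_close A B w -> op_close B A w.
Proof.
move=> H e v; have := H (vscal (-1) e) v.
by rewrite !dotZl vnormZ Rabs_Ropp Rabs_R1; lra.
Qed.

Lemma op_close_trans q p (A B C : mat q p) w w' :
  op_close A B w -> op_close B C w' -> op_close A C (w + w').
Proof. by move=> H H' e v; have := H e v; have := H' e v; lra. Qed.

(** * Calculus in one variable *)

Lemma derivable_pt_lim_eq (F G : R -> R) t l l' :
  (forall s, F s = G s) -> l = l' -> derivable_pt_lim F t l -> derivable_pt_lim G t l'.
Proof. by move=> /functional_extensionality <- <-. Qed.

Lemma derivable_pt_lim_sum (I : Type) (r : seq I) (F : I -> R -> R) (F' : I -> R) t :
  (forall i, derivable_pt_lim (F i) t (F' i)) ->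
  derivable_pt_lim (fun s => \big[Rplus/0]_(i <- r) F i s) t (\big[Rplus/0]_(i <- r) F' i).
Proof.
move=> H; elim: r => [|i r IH].
  apply: derivable_pt_lim_eq (derivable_pt_lim_const 0 t); last by rewrite big_nil.
  by move=> s; rewrite big_nil.
apply: derivable_pt_lim_eq (derivable_pt_lim_plus _ _ _ _ _ (H i) IH); last by rewrite big_cons.
by move=> s; rewrite big_cons.
Qed.

Lemma derivable_pt_lim_sqnorm n (u : R -> vec n) (u' : vec n) t :
  (forall i, derivable_pt_lim (fun s => u s i) t (u' i)) ->
  derivable_pt_lim (fun s => dot (u s) (u s)) t (2 * dot (u t) u').
Proof.
move=> H; rewrite /dot -sumrM.
apply: derivable_pt_lim_sum => i.
have := derivable_pt_lim_mult _ _ _ _ _ (H i) (H i).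
by apply: derivable_pt_lim_eq => [s|]; rewrite /mult_fct //; ring.
Qed.

Lemma derivable_pos_right (V : R -> R) t v : derivable_pt_lim V t v -> 0 <= V t -> 0 < v ->
  exists d, 0 < d /\ forall s, t <= s < t + d -> 0 <= V s.
Proof.
move=> /(_ _) dV V0 v0; have [d Hd] := dV v v0.
exists d; split; first exact: cond_pos.
move=> s [ts sd]; have [<-//|{}ts] : t = s \/ t < s by lra.
have h0 : s - t <> 0 by lra.
have hd : Rabs (s - t) < d by rewrite Rabs_pos_eq; lra.
have := Hd _ h0 hd; rewrite (_ : t + (s - t) = s); last ring.
move=> /Rabs_def2 [_ H].
have : (V s - V t) / (s - t) * (s - t) = V s - V t by field.
have : 0 < s - t by lra.
by set Q := (_ / _) in H *; nra.
Qed.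

Lemma continuous_neg_left (V : R -> R) t v : derivable_pt_lim V t v -> V t < 0 ->
  exists d, 0 < d /\ forall s, t - d < s <= t -> V s < 0.
Proof.
move=> dV V0.
have cV : continuity_pt V t by apply: derivable_continuous_pt; exists v.
have e0 : 0 < - V t by lra.
have [d [d0 Hd]] := cV _ e0.
exists d; split=> // s [sd st]; have [->//|{}st] : s = t \/ s < t by lra.
have : Rabs (V s - V t) < - V t.
  apply: (Hd s); split; last by rewrite /= /Rdist Rabs_left; lra.
  by split=> //; apply/not_eq_sym/Rlt_not_eq.
by move=> /Rabs_def2 []; lra.
Qed.

(** Continuous induction. Let [t1] be the supremum of the times up to which both functions are
    nonnegative. Continuity keeps them nonnegative at [t1], where the derivatives are then positive,
    so both stay nonnegative a little longer. Having two functions lets each sign be used to control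
    the derivative of the other. *)
Lemma barrier (V1 V2 v1 v2 : R -> R) T :
  (forall t, 0 <= t <= T -> derivable_pt_lim V1 t (v1 t) /\ derivable_pt_lim V2 t (v2 t)) ->
  0 <= V1 0 -> 0 <= V2 0 ->
  (forall t, 0 <= t <= T -> 0 <= V1 t -> 0 <= V2 t -> 0 < v1 t /\ 0 < v2 t) ->
  forall t, 0 <= t <= T -> 0 <= V1 t /\ 0 <= V2 t.
Proof.
move=> dV V10 V20 H t0 Ht0.
pose E t := 0 <= t <= T /\ forall s, 0 <= s <= t -> 0 <= V1 s /\ 0 <= V2 s.
have E0 : E 0.
  by split; [lra | move=> s Hs; rewrite (_ : s = 0); [| lra]].
have [||t1 [ub lub]] := completeness E.
- by exists T => t [[]].
- by exists 0.
have t10 : 0 <= t1 by exact: ub.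
have t1T : t1 <= T by apply: lub => t [[]].
have before s : 0 <= s < t1 -> 0 <= V1 s /\ 0 <= V2 s.
  move=> [s0 st1]; apply: NNPP => N.
  have : t1 <= s; last lra.
  apply: lub => t [_ Ht]; apply: Rnot_lt_le => st.
  by apply: N; apply: Ht; lra.
have [dV1 dV2] := dV t1 (conj t10 t1T).
have V11 : 0 <= V1 t1.
  have [->//|t1p] : t1 = 0 \/ 0 < t1 by lra.
  apply: Rnot_lt_le => N; have [d [d0 Hd]] := continuous_neg_left dV1 N.
  have [s0 sd] : 0 <= Rmax 0 (t1 - d / 2) /\ t1 - d / 2 <= Rmax 0 (t1 - d / 2).
    by split; [exact: Rmax_l | exact: Rmax_r].
  have st : Rmax 0 (t1 - d / 2) < t1 by apply: Rmax_lub_lt; lra.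
  have neg : V1 (Rmax 0 (t1 - d / 2)) < 0 by apply: Hd; lra.
  by have := before _ (conj s0 st); lra.
have V21 : 0 <= V2 t1.
  have [->//|t1p] : t1 = 0 \/ 0 < t1 by lra.
  apply: Rnot_lt_le => N; have [d [d0 Hd]] := continuous_neg_left dV2 N.
  have [s0 sd] : 0 <= Rmax 0 (t1 - d / 2) /\ t1 - d / 2 <= Rmax 0 (t1 - d / 2).
    by split; [exact: Rmax_l | exact: Rmax_r].
  have st : Rmax 0 (t1 - d / 2) < t1 by apply: Rmax_lub_lt; lra.
  have neg : V2 (Rmax 0 (t1 - d / 2)) < 0 by apply: Hd; lra.
  by have := before _ (conj s0 st); lra.
have [t01|t01] := Rle_lt_dec t0 t1.
  by have [->//|t01'] : t0 = t1 \/ t0 < t1; [lra | apply: before; lra].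
exfalso.
have [p1 p2] := H _ (conj t10 t1T) V11 V21.
have [d1 [d10 Hd1]] := derivable_pos_right dV1 V11 p1.
have [d2 [d20 Hd2]] := derivable_pos_right dV2 V21 p2.
have m1 := Rmin_l d1 d2; have m2 := Rmin_r d1 d2.
have m0 := Rmin_pos _ _ d10 d20.
(* A time past [t1] at which both functions are still nonnegative; the cap [t0] keeps it within the
   horizon. *)
pose t2 := Rmin (t1 + Rmin d1 d2 / 2) t0.
have a1 : t2 <= t1 + Rmin d1 d2 / 2 by exact: Rmin_l.
have a2 : t2 <= t0 by exact: Rmin_r.
have a3 : t1 < t2 by apply: Rmin_glb_lt; lra.
suff : t2 <= t1 by lra.
apply: ub; split; first by lra.
move=> s Hs; have [?|?] := Rle_lt_dec t1 s; last by apply: before; lra.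
have s2 : s <= t1 + Rmin d1 d2 / 2 by apply: Rle_trans a1; lra.
by split; [apply: Hd1 | apply: Hd2]; lra.
Qed.

(** * The product space *)

Section ProductSpace.
Variables n m : nat.
Implicit Types x y c : X n m.

(** Written as in [convexX], so that convexity applies to it as it stands. *)
Definition seg x y (s : R) : X n m :=
  ((fun i => (1 - s) * x.1 i + s * y.1 i), (fun j => (1 - s) * x.2 j + s * y.2 j)).

Lemma Xnorm_ge0 x : 0 <= Xnorm x. Proof. exact: sqrt_pos. Qed.

Lemma Xnorm2 x : Xnorm x ^ 2 = vnorm x.1 ^ 2 + vnorm x.2 ^ 2.
Proof.
have ? := dot_ge0 x.1; have ? := dot_ge0 x.2.
by rewrite !vnorm2 /Xnorm pow2_sqrt; lra.
Qed.

Lemma Xnorm_le_add x : Xnorm x <= vnorm x.1 + vnorm x.2.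
Proof.
have := Xnorm2 x; have := Xnorm_ge0 x; have := vnorm_ge0 x.1; have := vnorm_ge0 x.2.
by nra.
Qed.

Lemma Xnorm_sub_tri x y z : Xnorm (Xsub x z) <= Xnorm (Xsub x y) + Xnorm (Xsub y z).
Proof.
have := Xnorm2 (Xsub x z); have := Xnorm2 (Xsub x y); have := Xnorm2 (Xsub y z) => /=.
have := vnorm_sub_tri x.1 y.1 z.1; have := vnorm_sub_tri x.2 y.2 z.2.
have := Xnorm_ge0 (Xsub x z); have := Xnorm_ge0 (Xsub x y); have := Xnorm_ge0 (Xsub y z).
have := vnorm_ge0 (vsub x.1 y.1); have := vnorm_ge0 (vsub x.2 y.2).
have := vnorm_ge0 (vsub y.1 z.1); have := vnorm_ge0 (vsub y.2 z.2).
have := vnorm_ge0 (vsub x.1 z.1); have := vnorm_ge0 (vsub x.2 z.2).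
set a := vnorm (vsub x.1 z.1); set b := vnorm (vsub x.2 z.2).
set a1 := vnorm (vsub x.1 y.1); set b1 := vnorm (vsub x.2 y.2).
set a2 := vnorm (vsub y.1 z.1); set b2 := vnorm (vsub y.2 z.2).
set N := Xnorm (Xsub x z); set N1 := Xnorm (Xsub x y); set N2 := Xnorm (Xsub y z) => *.
(* Cauchy-Schwarz in the plane for the pairs of component norms, by Lagrange's identity. *)
have CS : a1 * a2 + b1 * b2 <= N1 * N2.
  have P12 : 0 <= N1 * N2 by nra.
  have : (a1 * a2 + b1 * b2) ^ 2 <= (N1 * N2) ^ 2.
    rewrite (_ : (N1 * N2) ^ 2 = N1 ^ 2 * N2 ^ 2); last ring.
    have -> : N1 ^ 2 = a1 ^ 2 + b1 ^ 2 by lra.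
    have -> : N2 ^ 2 = a2 ^ 2 + b2 ^ 2 by lra.
    by have := pow2_ge_0 (a1 * b2 - a2 * b1); nra.
  by nra.
have : N ^ 2 <= (N1 + N2) ^ 2 by nra.
by nra.
Qed.

Lemma Xnorm_seg x y s r :
  Xnorm (Xsub (seg x y r) (seg x y s)) = Rabs (r - s) * Xnorm (Xsub y x).
Proof.
have -> : Xsub (seg x y r) (seg x y s)
  = (vscal (r - s) (vsub y.1 x.1), vscal (r - s) (vsub y.2 x.2)).
  by congr pair; vext.
rewrite /Xnorm /= !dotZl !dotZr -sqrt_Rsqr_abs -sqrt_mult_alt; last exact: Rle_0_sqr.
by congr sqrt; rewrite /Rsqr; ring.
Qed.

Lemma seg0 x y : seg x y 0 = x.
Proof. by case: x => a z; congr pair; vext. Qed.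

Lemma seg1 x y : seg x y 1 = y.
Proof. by case: y => a z; congr pair; vext. Qed.

Lemma ball_seg k (u v c : vec k) r s : 0 <= s <= 1 ->
  vnorm (vsub u c) < r -> vnorm (vsub v c) < r ->
  vnorm (vsub (fun i => (1 - s) * u i + s * v i) c) < r.
Proof.
move=> s01 Hu Hv.
have -> : vsub (fun i => (1 - s) * u i + s * v i) c
  = vadd (vscal (1 - s) (vsub u c)) (vscal s (vsub v c)) by vext.
apply: Rle_lt_trans (vnorm_add _ _) _.
rewrite !vnormZ !Rabs_pos_eq; try lra.
have [->|s0] : s = 0 \/ 0 < s by lra.
  by lra.
by nra.
Qed.

(** The chain rule, tested against a fixed [w]: this yields a real function, to which the
    one-variable mean value theorem applies. *)
Lemma derivable_along_seg q (F : X n m -> vec q) La Lz x y s (w : vec q) :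
  frechetX F (seg x y s) La Lz ->
  derivable_pt_lim (fun r => dot w (F (seg x y r))) s
    (dot w (vadd (mapply La (vsub y.1 x.1)) (mapply Lz (vsub y.2 x.2)))).
Proof.
move=> HF eps eps0.
set v := vadd _ _; set L := Xnorm (Xsub y x); set W := vnorm w.
have L0 : 0 <= L := Xnorm_ge0 _; have W0 : 0 <= W := vnorm_ge0 _.
(* The added ones keep the divisor positive when [w] vanishes or [x = y]. *)
have P : 0 < (W + 1) * (L + 1) by nra.
have e0 : 0 < eps / ((W + 1) * (L + 1)) by apply: Rdiv_lt_0_compat.
have [d [d0 Hd]] := HF _ e0.
have dL : 0 < d / (L + 1) by apply: Rdiv_lt_0_compat; lra.
exists (mkposreal _ dL) => h h0 /= hd.
have hdL : Rabs h * L < d.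
  have : Rabs h * (L + 1) < d.
    have -> : d = d / (L + 1) * (L + 1) by field; lra.
    by apply: Rmult_lt_compat_r; lra.
  by have := Rabs_pos h; nra.
have := Hd (seg x y (s + h)).
rewrite Xnorm_seg (_ : s + h - s = h) -/L; last ring.
move=> /(_ hdL).
set r := (fun i => _).
have -> : r = vsub (vsub (F (seg x y (s + h))) (F (seg x y s))) (vscal h v).
  have E1 : vsub (seg x y (s + h)).1 (seg x y s).1 = vscal h (vsub y.1 x.1) by vext.
  have E2 : vsub (seg x y (s + h)).2 (seg x y s).2 = vscal h (vsub y.2 x.2) by vext.
  by rewrite /r E1 E2 !mapplyZ /v; vext.
set rr := vsub _ _ => Hr.
have -> : (dot w (F (seg x y (s + h))) - dot w (F (seg x y s))) / h - dot w v = dot w rr / h.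
  by rewrite /rr !dotBr dotZr; field.
rewrite /Rdiv Rabs_mult Rabs_inv.
have habs : 0 < Rabs h by exact: Rabs_pos_lt.
apply: (Rmult_lt_reg_r (Rabs h)) => //.
rewrite Rmult_assoc Rinv_l ?Rmult_1_r; last lra.
have bd : Rabs (dot w rr) <= W * vnorm rr.
  by apply: Rabs_le; split; [exact: dot_ge | exact: dot_le].
apply: Rle_lt_trans bd _.
apply: Rle_lt_trans (_ : W * (eps / ((W + 1) * (L + 1)) * (Rabs h * L)) < _).
  by apply: Rmult_le_compat_l.
have -> : W * (eps / ((W + 1) * (L + 1)) * (Rabs h * L))
  = eps * Rabs h * ((W * L) / ((W + 1) * (L + 1))) by field; lra.
rewrite -[X in _ < X]Rmult_1_r; apply: Rmult_lt_compat_l; first nra.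
apply: (Rmult_lt_reg_r ((W + 1) * (L + 1))) => //.
by rewrite /Rdiv Rmult_assoc Rinv_l; nra.
Qed.

End ProductSpace.

(** * Pairs of solutions *)

Section Dynamics.
Variables (n m : nat) (f : X n m -> vec n) (g : X n m -> vec m) (U : X n m -> Prop).
Variables (Daf : X n m -> mat n n) (Dzf : X n m -> mat n m).
Variables (Dag : X n m -> mat m n) (Dzg : X n m -> mat m m).
Variables (alpha ell : X n m -> R) (c1 : R).
Hypothesis HUopen : openX U.
Hypothesis HUconv : convexX U.
Hypothesis HUcone : exists d, 0 < d /\
  forall x, U x -> forall x', cone x x' -> U x' -> boxB d x x'.
Hypothesis Hf : C1X_on U f Daf Dzf.
Hypothesis Hg : C1X_on U g Dag Dzg.
Hypothesis Halpha : contX_on U alpha.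
Hypothesis c1_gt0 : 0 < c1.
Hypothesis Hbounds : forall x, U x ->
  0 < alpha x /\ 0 <= ell x /\
  (forall a' : vec n, dot a' (mapply (Daf x) a') >= alpha x * vnorm a' ^ 2) /\
  (forall z' : vec m, dot z' (mapply (Dzg x) z') <= ell x * vnorm z' ^ 2) /\
  alpha x >= ell x + opnorm (Dzf x) + opnorm (Dag x) + c1.

Definition da (x y : X n m) : vec n := vsub y.1 x.1.
Definition dz (x y : X n m) : vec m := vsub y.2 x.2.

(** The mean value theorem is applied to the sum of both tested components, so that a single
    intermediate point serves [f] and [g] together. *)
Lemma mvt_seg x y (w1 : vec n) (w2 : vec m) : U x -> U y ->
  exists s, 0 < s < 1 /\ U (seg x y s) /\
    dot w1 (vsub (f y) (f x)) + dot w2 (vsub (g y) (g x)) =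
    dot w1 (vadd (mapply (Daf (seg x y s)) (da x y)) (mapply (Dzf (seg x y s)) (dz x y))) +
    dot w2 (vadd (mapply (Dag (seg x y s)) (da x y)) (mapply (Dzg (seg x y s)) (dz x y))).
Proof.
move=> Ux Uy.
have Us s : 0 <= s <= 1 -> U (seg x y s) by move=> Hs; exact: HUconv.
pose F s := dot w1 (f (seg x y s)) + dot w2 (g (seg x y s)).
pose F' s :=
  dot w1 (vadd (mapply (Daf (seg x y s)) (da x y)) (mapply (Dzf (seg x y s)) (dz x y))) +
  dot w2 (vadd (mapply (Dag (seg x y s)) (da x y)) (mapply (Dzg (seg x y s)) (dz x y))).
have [] := MVT_cor2 F F' 0 1; first lra.
  move=> s Hs; apply: derivable_pt_lim_plus; apply: derivable_along_seg.
    by apply: (proj1 Hf); exact: Us.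
  by apply: (proj1 Hg); exact: Us.
move=> s [E Hs]; exists s; split=> //; split; first by apply: Us; lra.
rewrite -/(F' s) !dotBr.
by move: E; rewrite /F !seg0 !seg1; lra.
Qed.

(** The right-hand side is half the derivative of [mu * |da| ^ 2 - k * |dz| ^ 2] along a pair of
    solutions. Weights (1, 1) control the cone, (1, 0) the growth of [da], (0, 1) the growth of
    [dz], and (1, [tau]) a moving cone. *)
Lemma cone_ineq x y mu k : U x -> U y -> 0 <= mu -> 0 <= k ->
  exists s, 0 < s < 1 /\ let xi := seg x y s in U xi /\
    mu * alpha xi * vnorm (da x y) ^ 2
    - (mu * opnorm (Dzf xi) + k * opnorm (Dag xi)) * (vnorm (da x y) * vnorm (dz x y))
    - k * ell xi * vnorm (dz x y) ^ 2 <=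
    mu * dot (da x y) (vsub (f y) (f x)) - k * dot (dz x y) (vsub (g y) (g x)).
Proof.
move=> Ux Uy mu0 k0.
have [s [Hs [Us E]]] := mvt_seg (vscal mu (da x y)) (vscal (- k) (dz x y)) Ux Uy.
exists s; split=> //; split=> //; move: E Us; set xi := seg x y s => E Us.
have [a0 [l0 [Ha [Hl _]]]] := Hbounds Us.
move: E; rewrite !dotZl !dotDr => E.
have := Ha (da x y); have := Hl (dz x y).
have := dot_mapply_ge (Dzf xi) (da x y) (dz x y).
have := dot_mapply_le (Dag xi) (dz x y) (da x y).
move: E; set p1 := dot _ _; set p2 := dot _ _; set p3 := dot _ _; set p4 := dot _ _.
set p5 := dot _ _; set p6 := dot _ _ => E I1 I2 I3 I4.
have J1 := Rmult_le_compat_l _ _ _ k0 I1.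
have J2 := Rmult_le_compat_l _ _ _ mu0 I2.
have J3 := Rmult_le_compat_l _ _ _ k0 I3.
have J4 := Rmult_le_compat_l _ _ _ mu0 (Rge_le _ _ I4).
by lra.
Qed.

Definition global_solution (x : X n m) (phi : R -> X n m) :=
  phi 0 = x /\ forward_solution f g phi /\ forall t, 0 <= t -> U (phi t).

Lemma derivable_da2 x y phi psi t : global_solution x phi -> global_solution y psi -> 0 <= t ->
  derivable_pt_lim (fun s => dot (da (phi s) (psi s)) (da (phi s) (psi s))) t
    (2 * dot (da (phi t) (psi t)) (vsub (f (psi t)) (f (phi t)))).
Proof.
move=> [_ [Hphi _]] [_ [Hpsi _]] t0; apply: derivable_pt_lim_sqnorm => i.
by apply: derivable_pt_lim_minus; [apply: (Hpsi t t0).1 | apply: (Hphi t t0).1].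
Qed.

Lemma derivable_dz2 x y phi psi t : global_solution x phi -> global_solution y psi -> 0 <= t ->
  derivable_pt_lim (fun s => dot (dz (phi s) (psi s)) (dz (phi s) (psi s))) t
    (2 * dot (dz (phi t) (psi t)) (vsub (g (psi t)) (g (phi t)))).
Proof.
move=> [_ [Hphi _]] [_ [Hpsi _]] t0; apply: derivable_pt_lim_sqnorm => i.
by apply: derivable_pt_lim_minus; [apply: (Hpsi t t0).2 | apply: (Hphi t t0).2].
Qed.

(** Linear growth is enough: inside the cone the derivative of [|da| ^ 2] exceeds [k * c1], where
    [k] is its initial value, while staying in the cone confines [|da|] to at most [d]. *)
Lemma cone_sep x y phi psi : global_solution x phi -> global_solution y psi -> x <> y ->
  vnorm (da x y) < vnorm (dz x y).
Proof.
move=> Sx Sy xy; apply: Rnot_le_lt => N.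
have [d [d0 Hd]] := HUcone.
have a0 := vnorm_ge0 (da x y); have z0 := vnorm_ge0 (dz x y).
have ap : 0 < vnorm (da x y).
  case: a0 => // a0; case: xy.
  have z00 : vnorm (dz x y) = 0 by lra.
  move: (vsub_eq0 (esym a0)) (vsub_eq0 z00).
  by case: (x) (y) => [? ?] [? ?] /= -> ->.
pose D s := dot (da (phi s) (psi s)) (da (phi s) (psi s)).
pose Z s := dot (dz (phi s) (psi s)) (dz (phi s) (psi s)).
pose D' s := 2 * dot (da (phi s) (psi s)) (vsub (f (psi s)) (f (phi s))).
pose Z' s := 2 * dot (dz (phi s) (psi s)) (vsub (g (psi s)) (g (phi s))).
pose k := vnorm (da x y) ^ 2.
have k0 : 0 < k by rewrite /k; nra.
(* At this time the lower bound [k * (1 + c1 * T)] equals [k + d ^ 2], beyond what the box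
   allows. *)
pose T := d ^ 2 / (k * c1).
have T0 : 0 <= T.
  by apply: Rlt_le; apply: Rdiv_lt_0_compat; nra.
have D0 : D 0 = k by rewrite /D Sx.1 Sy.1 -vnorm2.
have Z0 : Z 0 <= k by rewrite /Z Sx.1 Sy.1 -vnorm2 /k; nra.
have [] := @barrier (fun s => D s - Z s) (fun s => D s - k * (1 + c1 * s))
  (fun s => D' s - Z' s) (fun s => D' s - k * c1) T _ _ _ _ T; last 1 first.
- move=> VT1 VT2.
  have UT1 := Sx.2.2 T T0; have UT2 := Sy.2.2 T T0.
  have HC : cone (phi T) (psi T).
    move: VT1; rewrite /cone /Lf /D /Z -!vnorm2 /da /dz.
    by rewrite (vnorm_subC (phi T).1) (vnorm_subC (phi T).2).
  have [box _] := Hd _ UT1 _ HC UT2.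
  move: VT2; rewrite /D -vnorm2 {1}/T.
  rewrite (_ : k * (1 + c1 * (d ^ 2 / (k * c1))) = k + d ^ 2); last by field; lra.
  have := vnorm_ge0 (da (phi T) (psi T)).
  have : vnorm (da (phi T) (psi T)) <= d := box.
  set v := vnorm _ => vd v0 H.
  have : v ^ 2 <= d ^ 2 by nra.
  by lra.
- move=> t [t0 _]; split; apply: derivable_pt_lim_minus.
  + exact: derivable_da2 Sx Sy t0.
  + exact: derivable_dz2 Sx Sy t0.
  + exact: derivable_da2 Sx Sy t0.
  + have := derivable_pt_lim_scal _ k _ _ (derivable_pt_lim_plus _ _ _ _ _
      (derivable_pt_lim_const 1 t) (derivable_pt_lim_scal _ c1 _ _ (derivable_pt_lim_id t))).
    by apply: derivable_pt_lim_eq => [s|]; rewrite /mult_real_fct /plus_fct /fct_cte /id //; ring.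
- by rewrite D0; lra.
- by rewrite D0; lra.
- move=> t [t0 _] V1 V2.
  have UT1 := Sx.2.2 t t0; have UT2 := Sy.2.2 t t0.
  have ct : 0 <= c1 * t by nra.
  have Dk : k <= D t by nra.
  have E1 := vnorm2 (da (phi t) (psi t)); have E2 := vnorm2 (dz (phi t) (psi t)).
  move: V1; rewrite /D /Z -E1 -E2 => V1.
  move: Dk; rewrite /D -E1 => Dk.
  have a1 := vnorm_ge0 (da (phi t) (psi t)); have z1 := vnorm_ge0 (dz (phi t) (psi t)).
  have za : vnorm (dz (phi t) (psi t)) <= vnorm (da (phi t) (psi t)) by nra.
  have o1 : 0 <= 1 by lra. have o0 : 0 <= 0 by lra.
  (* The two barrier derivatives come from different intermediate points, [s] and [r]; the bounds of
     Hypothesis 2 are used at each. *)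
  have [s [_ [Us]]] := cone_ineq UT1 UT2 o1 o1.
  have [r [_ [Ur]]] := cone_ineq UT1 UT2 o1 o0.
  rewrite /D' /Z'.
  have [A0 [L0 [_ [_ AL]]]] := Hbounds Us; have [B0 [M0 [_ [_ BL]]]] := Hbounds Ur.
  have b1 := opnorm_ge0 (Dzf (seg (phi t) (psi t) s)).
  have b2 := opnorm_ge0 (Dag (seg (phi t) (psi t) s)).
  have b3 := opnorm_ge0 (Dzf (seg (phi t) (psi t) r)).
  have b4 := opnorm_ge0 (Dag (seg (phi t) (psi t) r)).
  move: V1 V2 Dk a1 z1 za A0 L0 AL B0 M0 BL b1 b2 b3 b4.
  set a := vnorm _; set z := vnorm _.
  move=> V1 V2 Dk a1 z1 za A0 L0 AL B0 M0 BL b1 b2 b3 b4 I1 I2.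
  have az : a * z <= a ^ 2 by nra.
  have zz : z ^ 2 <= a ^ 2 by nra.
  have kc : 0 < k * c1 by nra.
  have kca : k * c1 <= c1 * a ^ 2 by nra.
  split.
    set A := alpha _ in I2 AL A0; set L := ell _ in I2 AL L0.
    set p := opnorm _ in I2 AL b1; set q := opnorm _ in I2 AL b2.
    have : c1 * a ^ 2 <= A * a ^ 2 - (p + q) * (a * z) - L * z ^ 2.
      have P1 : (p + q) * (a * z) <= (p + q) * a ^ 2 by apply: Rmult_le_compat_l; lra.
      have P2 : L * z ^ 2 <= L * a ^ 2 by apply: Rmult_le_compat_l; lra.
      have P3 : (L + p + q + c1) * a ^ 2 <= A * a ^ 2 by apply: Rmult_le_compat_r; nra.
      by lra.
    by lra.
  set A := alpha _ in I1 BL B0; set L := ell _ in I1 BL M0.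
  set p := opnorm _ in I1 BL b3; set q := opnorm _ in I1 BL b4.
  have : c1 * a ^ 2 <= A * a ^ 2 - p * (a * z).
    have P1 : p * (a * z) <= p * a ^ 2 by apply: Rmult_le_compat_l; lra.
    have P3 : (p + c1) * a ^ 2 <= A * a ^ 2 by apply: Rmult_le_compat_r; nra.
    by lra.
  by lra.
- by lra.
Qed.

(** * Uniform control near a trajectory *)

Lemma op_close_local q p (M : X n m -> mat q p) x w :
  mat_contX_on U M -> U x -> 0 < w ->
  exists r, 0 < r /\ forall y, U y -> Xnorm (Xsub y x) < r -> op_close (M y) (M x) w.
Proof.
move=> HM Ux w0.
have p0 := pos_INR p; have q0 := pos_INR q.
(* The added one covers empty matrices. *)
have K1 : 0 < INR q * INR p + 1 by nra.
have e0 : 0 < w / (INR q * INR p + 1) by apply: Rdiv_lt_0_compat.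
set e1 := w / _ in e0.
have [r [r0 Hr]] : exists r, 0 < r /\ forall i : 'I_q, forall j : 'I_p,
    forall y, U y -> Xnorm (Xsub y x) < r -> Rabs (M y i j - M x i j) < e1.
  apply: (@finite_radius q (fun i r => forall j : 'I_p,
    forall y, U y -> Xnorm (Xsub y x) < r -> Rabs (M y i j - M x i j) < e1)).
    by move=> i r r' rr' H j y Uy yr; apply: H => //; lra.
  move=> i.
  apply: (@finite_radius p (fun j r =>
    forall y, U y -> Xnorm (Xsub y x) < r -> Rabs (M y i j - M x i j) < e1)).
    by move=> j r r' rr' H y Uy yr; apply: H => //; lra.
  by move=> j; have [d Hd] := HM i j x Ux e1 e0; exists d.
exists r; split=> // y Uy yr e v.
rewrite -dotBr.
have -> : vsub (mapply (M y) v) (mapply (M x) v) = mapply (fun i j => M y i j - M x i j) v.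
  apply: functional_extensionality => i.
  rewrite /vsub /mapply.
  have -> : \big[Rplus/0]_(j < p) ((M y i j - M x i j) * v j)
    = \big[Rplus/0]_(j < p) (M y i j * v j + -1 * (M x i j * v j)).
    by apply: eq_bigr => j _; ring.
  by rewrite big_split sumrM /=; ring.
apply: Rle_trans (bilinear_le _ _ (Rlt_le _ _ e0) _) _.
  by move=> i j; apply: Rlt_le; apply: Hr.
have ev : 0 <= vnorm e * vnorm v.
  by have := vnorm_ge0 e; have := vnorm_ge0 v; nra.
have : INR q * INR p * e1 <= w.
  have : (INR q * INR p + 1) * e1 = w by rewrite /e1; field; lra.
  by nra.
by nra.
Qed.

(** The squared distance to [phi t] is a differentiable real function of time that vanishes at
    [t]. *)
Lemma solution_continuous x phi t r : global_solution x phi -> 0 <= t -> 0 < r ->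
  exists d, 0 < d /\ forall s, Rabs (s - t) < d -> Xnorm (Xsub (phi s) (phi t)) < r.
Proof.
move=> [_ [Hphi _]] t0 r0.
pose F s := dot (vsub (phi s).1 (phi t).1) (vsub (phi s).1 (phi t).1)
          + dot (vsub (phi s).2 (phi t).2) (vsub (phi s).2 (phi t).2).
have [c dF] : exists c, derivable_pt_lim F t c.
  eexists; apply: derivable_pt_lim_plus; apply: derivable_pt_lim_sqnorm => i.
    by apply: derivable_pt_lim_minus; [exact: (Hphi t t0).1 | exact: derivable_pt_lim_const].
  by apply: derivable_pt_lim_minus; [exact: (Hphi t t0).2 | exact: derivable_pt_lim_const].
have cF : continuity_pt F t by apply: derivable_continuous_pt; exists c.
have e0 : 0 < r ^ 2 by nra.
have [d [d0 Hd]] := cF _ e0.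
have Ft : F t = 0.
  rewrite /F /dot /vsub.
  by rewrite !big1 => [|i _|i _]; rewrite ?Rminus_diag; lra.
have Fs s : F s = Xnorm (Xsub (phi s) (phi t)) ^ 2 by rewrite Xnorm2 !vnorm2.
exists d; split=> // s sd; have N0 := Xnorm_ge0 (Xsub (phi s) (phi t)).
have [st|st] := Req_dec s t.
  by move: (Ft); rewrite -st Fs st; nra.
have : Rabs (F s - F t) < r ^ 2.
  by apply: (Hd s); split=> //; split=> //; apply/not_eq_sym.
by rewrite Ft Fs => /Rabs_def2 []; nra.
Qed.

Definition in_tube (c y : X n m) d := vnorm (da c y) < d /\ vnorm (dz c y) < d.

(* Bounding alpha by the inverse of the radius makes the uniform radius of the compactness
   argument also provide the uniform bound on alpha. *)
Definition controlled (c y : X n m) (d w : R) :=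
  U y /\ alpha y <= / d /\
  op_close (Daf y) (Daf c) w /\ op_close (Dzf y) (Dzf c) w /\
  op_close (Dag y) (Dag c) w /\ op_close (Dzg y) (Dzg c) w.

Lemma controlled_local c w : U c -> 0 < w ->
  exists r, 0 < r /\ forall y, Xnorm (Xsub y c) < r -> controlled c y r w.
Proof.
move=> Uc w0.
have [_ [Cf1 Cf2]] := Hf; have [_ [Cg1 Cg2]] := Hg.
have [r0 [r0p H0]] := HUopen Uc.
have [r1 [r1p H1]] := op_close_local Cf1 Uc w0.
have [r2 [r2p H2]] := op_close_local Cf2 Uc w0.
have [r3 [r3p H3]] := op_close_local Cg1 Uc w0.
have [r4 [r4p H4]] := op_close_local Cg2 Uc w0.
have [r5 [r5p H5]] := Halpha Uc Rlt_0_1.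
have [ac _] := Hbounds Uc.
(* Near [c], [alpha] stays below [alpha c + 1]; a radius at most the inverse of this gives
   [alpha y <= / r]. *)
have r6p : 0 < / (alpha c + 1) by apply: Rinv_0_lt_compat; lra.
have [r [rp [l0 [l1 [l2 [l3 [l4 [l5 l6]]]]]]]] : exists r, 0 < r /\ r <= r0 /\ r <= r1 /\ r <= r2
  /\ r <= r3 /\ r <= r4 /\ r <= r5 /\ r <= / (alpha c + 1).
  exists (Rmin r0 (Rmin r1 (Rmin r2 (Rmin r3 (Rmin r4 (Rmin r5 (/ (alpha c + 1)))))))).
  split; first by repeat (apply: Rmin_glb_lt => //).
  have L := Rmin_l; have Rr := Rmin_r.
  split; first by [].
  split; first by apply: Rle_trans (Rr _ _) _.
  split; first by do 2 (apply: Rle_trans (Rr _ _) _).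
  split; first by do 3 (apply: Rle_trans (Rr _ _) _).
  split; first by do 4 (apply: Rle_trans (Rr _ _) _).
  split; first by do 5 (apply: Rle_trans (Rr _ _) _).
  by do 5 (apply: Rle_trans (Rr _ _) _).
exists r; split=> // y yr.
have Uy : U y by apply: H0; lra.
split=> //; split.
  have : Rabs (alpha y - alpha c) < 1 by apply: H5 => //; lra.
  move=> /Rabs_def2 [A _].
  have : alpha c + 1 <= / r.
    by rewrite -(Rinv_inv (alpha c + 1)); apply: Rinv_le_contravar.
  by lra.
by split; [apply: H1|split; [apply: H2|split; [apply: H3|apply: H4]]] => //; lra.
Qed.

(** Each time has a local radius valid for all nearby centres [phi s], and compactness of the time
    interval bounds these radii below. The centre moves with the trajectory, so derivatives at [y]
    and at [phi s] are compared through [phi t], with error [w / 2] each. *)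
Lemma tube x phi T w : global_solution x phi -> 0 < w ->
  exists d, 0 < d /\ forall t y, 0 <= t <= T -> in_tube (phi t) y d -> controlled (phi t) y d w.
Proof.
move=> Sx w0.
have w2 : 0 < w / 2 by lra.
have loc t : { dl : posreal | 0 <= t <= T -> forall s y, Rabs (s - t) < dl ->
    Xnorm (Xsub y (phi s)) < 2 * dl -> controlled (phi s) y dl w }.
  apply: constructive_indefinite_description.
  have [Ht|Ht] : 0 <= t <= T \/ ~ (0 <= t <= T) by lra.
    have Ut := Sx.2.2 t Ht.1.
    have [r [r0 Hr]] := controlled_local Ut w2.
    have r2 : 0 < r / 2 by lra.
    have [eta [eta0 Heta]] := solution_continuous Sx Ht.1 r2.
    (* With a radius at most [r / 4], [y] lies within [r / 2] of [phi s], which lies within [r / 2]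
       of [phi t]. The factor 2 in [loc] is the cost of passing from the two component norms to
       [Xnorm]. *)
    have m1 := Rmin_l eta (r / 4); have m2 := Rmin_r eta (r / 4).
    have m0 : 0 < Rmin eta (r / 4) by apply: Rmin_glb_lt; lra.
    exists (mkposreal _ m0) => _ s y /= st ys.
    have s1 := Heta s (Rlt_le_trans _ _ _ st m1).
    have tri := Xnorm_sub_tri y (phi s) (phi t).
    have [Uy [Ay [A1 [A2 [A3 A4]]]]] := Hr y ltac:(lra).
    have [Us [As [B1 [B2 [B3 B4]]]]] := Hr (phi s) ltac:(lra).
    split=> //; split.
      by apply: Rle_trans Ay _; apply: Rinv_le_contravar; lra.
    have -> : w = w / 2 + w / 2 by lra.
    by do 3?split; apply: op_close_trans; try eassumption; apply: op_close_sym.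
  by exists (mkposreal 1 Rlt_0_1) => /Ht.
have [d Hd] := Coquelicot.Compactness.compactness_value_1d 0 T (fun t => sval (loc t)).
exists d; split; first exact: cond_pos.
move=> t y Ht [ya yz].
(* The compactness statement gives its covering time only under a double negation. *)
apply: NNPP => N; apply: (Hd t Ht) => - [s [Hs [ts ds]]]; apply: N.
have d0 := cond_pos d.
move: ts ds; case: (loc s) => dl /= Hdl ts ds.
have [] := Hdl Hs t y ts.
  by have := Xnorm_le_add (Xsub y (phi t)); move: ya yz; rewrite /da /dz /=; lra.
move=> Uy [Ay A]; split=> //; split=> //.
by apply: Rle_trans Ay _; apply: Rinv_le_contravar.
Qed.

(** * The invariant set *)

Variable Gamma : X n m -> Prop.
Hypothesis HGinv : pos_invariant f g U Gamma.

Definition Gsol (x : X n m) phi := global_solution x phi /\ forall t, 0 <= t -> Gamma (phi t).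

Lemma Gamma_sol x : Gamma x -> exists phi, Gsol x phi.
Proof.
by move=> /(HGinv.2) [phi [H0 [H1 [H2 H3]]]]; exists phi.
Qed.

Lemma Gamma_sep x y : Gamma x -> Gamma y -> x <> y -> vnorm (da x y) < vnorm (dz x y).
Proof.
move=> /Gamma_sol [phi [Sx _]] /Gamma_sol [psi [Sy _]].
exact: cone_sep Sx Sy.
Qed.

Lemma Gamma_lip x y : Gamma x -> Gamma y -> vnorm (da x y) <= vnorm (dz x y).
Proof.
move=> Gx Gy; have [->|xy] := excluded_middle_informative (x = y).
  by rewrite vnorm_subvv; exact: vnorm_ge0.
exact/Rlt_le/Gamma_sep.
Qed.

Lemma in_tube_seg c x y d s : 0 <= s <= 1 -> in_tube c x d -> in_tube c y d ->
  in_tube c (seg x y s) d.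
Proof. by move=> Hs [x1 x2] [y1 y2]; split; apply: ball_seg. Qed.

Lemma in_tube_center c d : 0 < d -> in_tube c c d.
Proof. by split; rewrite vnorm_subvv. Qed.

(** A Gronwall estimate. On pairs of points of [Gamma] the [a]-difference is bounded by the
    [z]-difference, and in the tube [alpha <= / d] bounds [ell] plus the norm of [Dag]; so [|dz|]
    grows at rate at most [/ d]. *)
Lemma stay_in_tube x0 phi T d w : Gsol x0 phi -> 0 <= T -> 0 < d ->
  (forall t y, 0 <= t <= T -> in_tube (phi t) y d -> controlled (phi t) y d w) ->
  exists rho, 0 < rho /\ forall x psi, Gsol x psi -> vnorm (dz x0 x) < rho ->
    forall t, 0 <= t <= T -> in_tube (phi t) (psi t) d.
Proof.
move=> [S0 G0] T0 d0 Htube.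
have id0 := Rinv_0_lt_compat _ d0.
(* The extra 1 makes the barrier derivative strictly positive; [rho] is chosen so that
   [rho * exp (M * T) = d / 2]. *)
pose M := / d + 1.
pose rho := d / 2 * exp (- (M * T)).
have e0 := exp_pos (- (M * T)).
have rho0 : 0 < rho by rewrite /rho; nra.
exists rho; split=> // x psi [Sx Gx] Hx t Ht.
pose N s := dot (dz (phi s) (psi s)) (dz (phi s) (psi s)).
pose N' s := 2 * dot (dz (phi s) (psi s)) (vsub (g (psi s)) (g (phi s))).
pose V s := rho ^ 2 * exp (2 * M * s) - N s.
pose V' s := rho ^ 2 * (2 * M * exp (2 * M * s)) - N' s.
have small s : 0 <= s <= T -> 0 <= V s -> in_tube (phi s) (psi s) d.
  move=> Hs; rewrite /V /N -vnorm2 => Vs.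
  have z0 := vnorm_ge0 (dz (phi s) (psi s)).
  have lip := Gamma_lip (G0 _ Hs.1) (Gx _ Hs.1).
  have B : rho ^ 2 * exp (2 * M * s) <= (d / 2) ^ 2.
    have -> : rho ^ 2 = (d / 2) ^ 2 * exp (- (2 * M * T)).
      rewrite (_ : - (2 * M * T) = - (M * T) + - (M * T)); last ring.
      by rewrite exp_plus /rho; ring.
    rewrite Rmult_assoc -exp_plus.
    have : exp (- (2 * M * T) + 2 * M * s) <= 1.
      have : M * s <= M * T by apply: Rmult_le_compat_l; rewrite /M; lra.
      move=> Mst; have [->|neg] : - (2 * M * T) + 2 * M * s = 0 \/ - (2 * M * T) + 2 * M * s < 0 by lra.
        by rewrite exp_0; lra.
      by have := exp_increasing _ _ neg; rewrite exp_0; lra.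
    by have := pow2_ge_0 (d / 2); nra.
  have : vnorm (dz (phi s) (psi s)) <= d / 2 by nra.
  by split; lra.
apply: (small) => //.
(* A single constraint, passed twice. *)
have [] // := @barrier V V V' V' T _ _ _ _ t Ht.
- move=> s Hs.
  suff D : derivable_pt_lim V s (V' s) by [].
  apply: derivable_pt_lim_minus; last exact: derivable_dz2 S0 Sx Hs.1.
  apply: (derivable_pt_lim_scal (fun s => exp (2 * M * s))).
  have := derivable_pt_lim_comp _ exp _ _ _
    (derivable_pt_lim_scal _ (2 * M) s _ (derivable_pt_lim_id s)) (derivable_pt_lim_exp _).
  apply: derivable_pt_lim_eq => [r|]; rewrite /Ranalysis1.comp /mult_real_fct /Ranalysis1.id //.
  by ring.
- rewrite /V /N -vnorm2 S0.1 Sx.1 Rmult_0_r exp_0.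
  by have := vnorm_ge0 (dz x0 x); nra.
- rewrite /V /N -vnorm2 S0.1 Sx.1 Rmult_0_r exp_0.
  by have := vnorm_ge0 (dz x0 x); nra.
- move=> s Hs Vs _; suff : 0 < V' s by [].
  have Ts := small s Hs Vs.
  have U0 := S0.2.2 s Hs.1; have U1 := Sx.2.2 s Hs.1.
  have o1 : 0 <= 1 by lra. have o0 : 0 <= 0 by lra.
  have [r [Hr [Ur]]] := cone_ineq U0 U1 o0 o1.
  have [_ [Ad _]] := Htube s _ Hs (in_tube_seg (conj (Rlt_le _ _ Hr.1) (Rlt_le _ _ Hr.2))
    (in_tube_center (phi s) d0) Ts).
  have [A0 [L0 [_ [_ AL]]]] := Hbounds Ur.
  have lip := Gamma_lip (G0 _ Hs.1) (Gx _ Hs.1).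
  have b1 := opnorm_ge0 (Dzf (seg (phi s) (psi s) r)).
  have b2 := opnorm_ge0 (Dag (seg (phi s) (psi s) r)).
  have a0 := vnorm_ge0 (da (phi s) (psi s)); have z0 := vnorm_ge0 (dz (phi s) (psi s)).
  move: Vs; rewrite /V /V' /N /N' -vnorm2.
  move: Ad A0 L0 AL lip b1 b2 a0 z0.
  have e1 := exp_pos (2 * M * s).
  set a := vnorm (da _ _); set z := vnorm _; set A := alpha _; set L := ell _.
  set p := opnorm _; set q := opnorm _; set E := exp _ in e1 *; set G := dot (dz _ _) _.
  move=> Ad A0 L0 AL lip b1 b2 a0 z0 V0 I.
  have az : a * z <= z ^ 2 by nra.
  have P1 : q * (a * z) <= q * z ^ 2 by apply: Rmult_le_compat_l.
  have P2 : (q + L) * z ^ 2 <= / d * z ^ 2 by apply: Rmult_le_compat_r; [nra | lra].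
  have r2 : 0 < rho ^ 2 * E by apply: Rmult_lt_0_compat => //; nra.
  have P3 : / d * z ^ 2 <= / d * (rho ^ 2 * E) by apply: Rmult_le_compat_l; lra.
  rewrite /M; lra.
Qed.

(** The cone [tau s * |dz| ^ 2 <= |da| ^ 2] narrows from slope [th] at time 0 to slope 1 at time 1.
    A pair starting in the wide cone would stay in the moving one and end in the original cone,
    against [Gamma_sep]. Slopes concern squares, hence the constant [sqrt th]. *)
Lemma local_contraction x0 : Gamma x0 -> exists th rho, 0 <= th < 1 /\ 0 < rho /\
  forall x, Gamma x -> vnorm (dz x0 x) < rho -> vnorm (da x0 x) <= th * vnorm (dz x0 x).
Proof.
move=> G0; have [phi Sphi] := Gamma_sol G0.
have [S0 G0'] := Sphi.
have [d [d0 Htube]] := tube 1 S0 Rlt_0_1.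
have [rho [rho0 Hrho]] := stay_in_tube Sphi Rle_0_1 d0 Htube.
have id0 := Rinv_0_lt_compat _ d0.
pose M := / d.
(* [q] is the inverse of [th]. Widening the cone costs at most [M * (q - 1)] in the cross terms and
   its motion contributes a further [q - 1]; as [(M + 1) * (q - 1) = c1 / 2], the gap [c1] pays for
   both. *)
pose q := 1 + c1 / 2 / (M + 1).
have qM : (M + 1) * (q - 1) = c1 / 2 by rewrite /q; field; rewrite /M; lra.
have q1 : 1 < q.
  have : 0 < c1 / 2 / (M + 1) by apply: Rdiv_lt_0_compat; rewrite /M; lra.
  by rewrite /q; lra.
pose th := / q.
have thq : th * q = 1 by rewrite /th; field; lra.
have th0 : 0 < th by apply: Rinv_0_lt_compat; lra.
have th1 : th < 1 by nra.
exists (sqrt th), rho; split.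
  by split; [exact: sqrt_pos | rewrite -sqrt_1; apply: sqrt_lt_1_alt; lra].
split=> // x Gx Hx; apply: Rnot_lt_le => N.
have [psi Spsi] := Gamma_sol Gx; have [Sx Gx'] := Spsi.
have stay := Hrho _ _ Spsi Hx.
pose D s := dot (da (phi s) (psi s)) (da (phi s) (psi s)).
pose Z s := dot (dz (phi s) (psi s)) (dz (phi s) (psi s)).
pose D' s := 2 * dot (da (phi s) (psi s)) (vsub (f (psi s)) (f (phi s))).
pose Z' s := 2 * dot (dz (phi s) (psi s)) (vsub (g (psi s)) (g (phi s))).
pose tau s := th + (1 - th) * s.
have st0 := sqrt_lt_R0 _ th0.
have st2 := pow2_sqrt _ (Rlt_le _ _ th0).
have z00 := vnorm_ge0 (dz x0 x).
have a00 : 0 < vnorm (da x0 x) by nra.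
pose k := vnorm (da x0 x) ^ 2.
have k0 : 0 < k by rewrite /k; nra.
have DZ0 : th * vnorm (dz x0 x) ^ 2 <= k.
  rewrite -[X in X * _]st2 -Rpow_mult_distr /k; apply: pow_incr; split; last lra.
  by apply: Rmult_le_pos; lra.
have o1 : 0 <= 1 by lra. have o0 : 0 <= 0 by lra.
(* The second function keeps [|da| ^ 2] above [k], so the two points are still distinct at time 1
   and their separation is strict. *)
have [] := @barrier (fun s => D s - tau s * Z s) (fun s => D s - k)
  (fun s => D' s - ((1 - th) * Z s + tau s * Z' s)) (fun s => D' s) 1 _ _ _ _ 1; last 1 first.
- rewrite /tau /D /Z -!vnorm2 => V1 V2.
  have := Gamma_sep (G0' 1 o1) (Gx' 1 o1).
  have a1 := vnorm_ge0 (da (phi 1) (psi 1)); have z1 := vnorm_ge0 (dz (phi 1) (psi 1)).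
  move=> sep.
  have : vnorm (da (phi 1) (psi 1)) < vnorm (dz (phi 1) (psi 1)).
    by apply: sep => E; move: V2; rewrite E vnorm_subvv; lra.
  by nra.
- move=> s Hs; split.
    apply: derivable_pt_lim_minus; first exact: derivable_da2 S0 Sx Hs.1.
    apply: (derivable_pt_lim_mult tau); last exact: derivable_dz2 S0 Sx Hs.1.
    have := derivable_pt_lim_plus _ _ _ _ _ (derivable_pt_lim_const th s)
      (derivable_pt_lim_scal _ (1 - th) _ _ (derivable_pt_lim_id s)).
    by apply: derivable_pt_lim_eq => [r|];
      rewrite /plus_fct /mult_real_fct /fct_cte /Ranalysis1.id /tau //; ring.
  have := derivable_pt_lim_minus _ _ _ _ _ (derivable_da2 S0 Sx Hs.1) (derivable_pt_lim_const k s).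
  by apply: derivable_pt_lim_eq => [r|] //; rewrite /D' Rminus_0_r.
- rewrite /D /Z /tau S0.1 Sx.1 -!vnorm2 -/k; lra.
- rewrite /D S0.1 Sx.1 -!vnorm2 -/k; lra.
- move=> s Hs V1 V2.
  have U0 := S0.2.2 s Hs.1; have U1 := Sx.2.2 s Hs.1.
  have t1 : th <= tau s by rewrite /tau; nra.
  have t2 : tau s <= 1 by rewrite /tau; nra.
  have t0 : 0 <= tau s by lra.
  have [r [Hr [Ur]]] := cone_ineq U0 U1 o1 t0.
  have [r' [Hr' [Ur']]] := cone_ineq U0 U1 o1 o0.
  have tube_r u : 0 < u < 1 -> in_tube (phi s) (seg (phi s) (psi s) u) d.
    move=> Hu; apply: in_tube_seg (stay s Hs); [lra | exact: in_tube_center].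
  have [_ [Ad _]] := Htube s _ Hs (tube_r _ Hr).
  have [_ [Ad' _]] := Htube s _ Hs (tube_r _ Hr').
  have [A0 [L0 [_ [_ AL]]]] := Hbounds Ur.
  have [A0' [L0' [_ [_ AL']]]] := Hbounds Ur'.
  have b1 := opnorm_ge0 (Dzf (seg (phi s) (psi s) r)).
  have b2 := opnorm_ge0 (Dag (seg (phi s) (psi s) r)).
  have b1' := opnorm_ge0 (Dzf (seg (phi s) (psi s) r')).
  have b2' := opnorm_ge0 (Dag (seg (phi s) (psi s) r')).
  have a0 := vnorm_ge0 (da (phi s) (psi s)); have z0 := vnorm_ge0 (dz (phi s) (psi s)).
  move: V1 V2; rewrite /D' /Z' /D /Z -!vnorm2 => V1 V2.
  move: Ad Ad' A0 L0 AL A0' L0' AL' b1 b2 b1' b2' a0 z0 V1 V2; rewrite -/M.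
  move: (tau s) t1 t2 t0 => t t1 t2 t0.
  set a := vnorm (da _ _); set z := vnorm (dz _ _).
  move=> Ad Ad' A0 L0 AL A0' L0' AL' b1 b2 b1' b2' a0 z0 V1 V2 I' I.
  have zq : z ^ 2 <= q * a ^ 2.
    have P0 : th * z ^ 2 <= a ^ 2 by nra.
    have -> : z ^ 2 = q * (th * z ^ 2) by rewrite -Rmult_assoc (Rmult_comm q) thq; ring.
    by apply: Rmult_le_compat_l; lra.
  have azq : a * z <= q * a ^ 2.
    have zqa : z <= q * a.
      apply: Rnot_lt_le => zqa.
      have qa0 : 0 <= q * a by apply: Rmult_le_pos; lra.
      have : (q * a) ^ 2 < z ^ 2 by nra.
      have : q * a ^ 2 <= (q * a) ^ 2.
        have -> : (q * a) ^ 2 = q * (q * a ^ 2) by ring.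
        by have := pow2_ge_0 a; nra.
      by lra.
    have -> : q * a ^ 2 = a * (q * a) by ring.
    exact: Rmult_le_compat_l.
  have ap : 0 < a ^ 2 by lra.
  split.
    set A := alpha _ in I A0 AL Ad; set L := ell _ in I L0 AL.
    set p1 := opnorm _ in I AL b1; set p2 := opnorm _ in I AL b2.
    have P1 : (p1 + t * p2) * (a * z) <= (p1 + p2) * (q * a ^ 2).
      apply: Rle_trans (_ : (p1 + p2) * (a * z) <= _).
        by apply: Rmult_le_compat_r; nra.
      by apply: Rmult_le_compat_l; lra.
    have P2 : t * L * z ^ 2 <= L * a ^ 2.
      have -> : t * L * z ^ 2 = L * (t * z ^ 2) by ring.
      by apply: Rmult_le_compat_l; lra.
    have P3 : (1 - th) * z ^ 2 <= (q - 1) * a ^ 2.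
      have -> : (q - 1) * a ^ 2 = (1 - th) * (q * a ^ 2).
        have -> : (1 - th) * (q * a ^ 2) = (q - th * q) * a ^ 2 by ring.
        by rewrite thq.
      by apply: Rmult_le_compat_l; lra.
    have P4 : (c1 + (p1 + p2) + L) * a ^ 2 <= A * a ^ 2 by apply: Rmult_le_compat_r; lra.
    have P5 : (p1 + p2) * (q - 1) <= M * (q - 1) by apply: Rmult_le_compat_r; lra.
    have P6 : (p1 + p2) * (q - 1) * a ^ 2 <= (c1 / 2 - (q - 1)) * a ^ 2.
      by apply: Rmult_le_compat_r; lra.
    have P7 : 0 < c1 * a ^ 2 by nra.
    have P8 : 0 < (q - 1) * a ^ 2 by nra.
    by lra.
  set A := alpha _ in I' A0' AL' Ad'; set L := ell _ in I' L0' AL'.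
  set p1 := opnorm _ in I' AL' b1'; set p2 := opnorm _ in I' AL' b2'.
  have P1 : p1 * (a * z) <= p1 * (q * a ^ 2) by apply: Rmult_le_compat_l.
  have P4 : (c1 + p1) * a ^ 2 <= A * a ^ 2 by apply: Rmult_le_compat_r; lra.
  have P5 : p1 * (q - 1) <= M * (q - 1) by apply: Rmult_le_compat_r; lra.
  have P6 : p1 * (q - 1) * a ^ 2 <= (c1 / 2 - (q - 1)) * a ^ 2.
    by apply: Rmult_le_compat_r; lra.
  have P7 : 0 < c1 * a ^ 2 by nra.
  have P8 : 0 < (q - 1) * a ^ 2 by nra.
  by lra.
- by lra.
Qed.

(** * Difference quotients along a trajectory *)

(** The remainder is tested against itself, so the scalar mean value theorem applies; at the
    intermediate point the derivatives are [w]-close to those at the centre. *)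
Lemma linearization c d w P Q : 0 <= w -> U P -> U Q ->
  (forall y, in_tube c y d -> controlled c y d w) -> in_tube c P d -> in_tube c Q d ->
  vnorm (vsub (vsub (f Q) (f P)) (vadd (mapply (Daf c) (da P Q)) (mapply (Dzf c) (dz P Q))))
    <= w * (vnorm (da P Q) + vnorm (dz P Q)) /\
  vnorm (vsub (vsub (g Q) (g P)) (vadd (mapply (Dag c) (da P Q)) (mapply (Dzg c) (dz P Q))))
    <= w * (vnorm (da P Q) + vnorm (dz P Q)).
Proof.
move=> w0 UP UQ Ht tP tQ.
have a0 := vnorm_ge0 (da P Q); have z0 := vnorm_ge0 (dz P Q).
have r0 : 0 <= w * (vnorm (da P Q) + vnorm (dz P Q)) by nra.
split; apply: vnorm_le_of_dot => //; set e := vsub _ (vadd _ _).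
  have EE : dot e e = dot e (vsub (f Q) (f P))
    - (dot e (mapply (Daf c) (da P Q)) + dot e (mapply (Dzf c) (dz P Q))).
    by rewrite {2}/e dotBr dotDr.
  (* The second test vector is zero, which isolates [f]. *)
  have [s [Hs [Us E]]] := mvt_seg e (vscal 0 (dz P Q)) UP UQ.
  have s01 : 0 <= s <= 1 by lra.
  have [_ [_ [C1 [C2 _]]]] := Ht _ (in_tube_seg s01 tP tQ).
  have := C1 e (da P Q); have := C2 e (dz P Q).
  by move: E; rewrite EE !dotZl !dotDr; lra.
have EE : dot e e = dot e (vsub (g Q) (g P))
  - (dot e (mapply (Dag c) (da P Q)) + dot e (mapply (Dzg c) (dz P Q))).
  by rewrite {2}/e dotBr dotDr.
have [s [Hs [Us E]]] := mvt_seg (vscal 0 (da P Q)) e UP UQ.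
have s01 : 0 <= s <= 1 by lra.
have [_ [_ [_ [_ [C1 C2]]]]] := Ht _ (in_tube_seg s01 tP tQ).
have := C1 e (da P Q); have := C2 e (dz P Q).
by move: E; rewrite EE !dotZl !dotDr; lra.
Qed.

(** Since both points lie in [Gamma], [|da| + |dz| <= 2 * |dz|], so the error is measured by the
    [z]-quotient alone. *)
Lemma scaled_linearization c d w P Q s : 0 <= w -> Gamma P -> Gamma Q -> s <> 0 ->
  (forall y, in_tube c y d -> controlled c y d w) -> in_tube c P d -> in_tube c Q d ->
  let ua := vscal (/ s) (da P Q) in let uz := vscal (/ s) (dz P Q) in
  vnorm ua <= vnorm uz /\
  exists ra rz,
    vscal (/ s) (vsub (f Q) (f P)) = vadd (vadd (mapply (Daf c) ua) (mapply (Dzf c) uz)) ra /\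
    vscal (/ s) (vsub (g Q) (g P)) = vadd (vadd (mapply (Dag c) ua) (mapply (Dzg c) uz)) rz /\
    vnorm ra <= 2 * w * vnorm uz /\ vnorm rz <= 2 * w * vnorm uz.
Proof.
move=> w0 GP GQ s0 Ht tP tQ ua uz.
have lip := Gamma_lip GP GQ.
have is0 := Rabs_pos (/ s).
have z0 := vnorm_ge0 (dz P Q).
split; first by rewrite /ua /uz !vnormZ; nra.
have dble : w * (vnorm (da P Q) + vnorm (dz P Q)) <= 2 * w * vnorm (dz P Q) by nra.
have [E1 E2] := linearization w0 (HGinv.1 _ GP) (HGinv.1 _ GQ) Ht tP tQ.
exists (vscal (/ s) (vsub (vsub (f Q) (f P))
    (vadd (mapply (Daf c) (da P Q)) (mapply (Dzf c) (dz P Q))))).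
exists (vscal (/ s) (vsub (vsub (g Q) (g P))
    (vadd (mapply (Dag c) (da P Q)) (mapply (Dzg c) (dz P Q))))).
split; last split; last split.
- by rewrite /ua /uz !mapplyZ; vext.
- by rewrite /ua /uz !mapplyZ; vext.
- by rewrite /uz !vnormZ; have := Rmult_le_compat_l _ _ _ is0 (Rle_trans _ _ _ E1 dble); lra.
- by rewrite /uz !vnormZ; have := Rmult_le_compat_l _ _ _ is0 (Rle_trans _ _ _ E2 dble); lra.
Qed.

(** The real-number core of [quotients_close]. Here [a] and [z] are the component norms of the
    difference of two quotients, [y1] and [y2] the norms of their [z]-parts, and primes denote half
    derivatives. As long as [E * Y <= a ^ 2], the sum [y1 + y2] is at most [2 / eps * a], so the
    linearization errors are absorbed by the gap [c1]. *)
Lemma difference_growth (al p1 p2 l w eps y1 y2 a z Y D' Z' Y' E : R) :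
  0 <= p1 -> 0 <= p2 -> 0 <= l -> al >= l + p1 + p2 + c1 ->
  0 < eps -> 0 <= w -> w <= c1 / 16 -> w <= eps * c1 / 16 ->
  0 <= y1 -> 0 <= y2 -> 0 < a -> 0 <= z -> z ^ 2 <= a ^ 2 ->
  Y = 2 * (y1 ^ 2 + y2 ^ 2) -> eps ^ 2 / 4 <= E -> E * Y <= a ^ 2 ->
  al * a ^ 2 - p1 * (a * z) - 2 * w * (y1 + y2) * a <= D' ->
  Z' <= l * z ^ 2 + p2 * (a * z) + 2 * w * (y1 + y2) * z ->
  Y' <= (l + p2 + 2 * w) * Y ->
  0 < D' - Z' /\ 0 < D' - E * (c1 / 4 * Y + Y').
Proof.
move=> p10 p20 l0 AL eps0 w0 wc wec y10 y20 a0 z0 za EY E4 EYa HD HZ HY.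
have za' : z <= a by nra.
have Y0 : 0 <= Y by rewrite EY; nra.
have e0 : 0 < eps ^ 2 / 4 by nra.
have yY : (y1 + y2) ^ 2 <= Y by rewrite EY; have := pow2_ge_0 (y1 - y2); lra.
have ya : eps / 2 * (y1 + y2) <= a.
  apply: Rnot_lt_le => N.
  have : a ^ 2 < (eps / 2 * (y1 + y2)) ^ 2.
    have -> r : r ^ 2 = r * r by ring.
    by apply: Rmult_le_0_lt_compat; lra.
  have -> : (eps / 2 * (y1 + y2)) ^ 2 = eps ^ 2 / 4 * (y1 + y2) ^ 2 by field.
  have : eps ^ 2 / 4 * (y1 + y2) ^ 2 <= eps ^ 2 / 4 * Y by apply: Rmult_le_compat_l; lra.
  have : eps ^ 2 / 4 * Y <= E * Y by apply: Rmult_le_compat_r.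
  by lra.
have wy : 2 * w * (y1 + y2) <= c1 / 4 * a.
  have : w * (y1 + y2) <= eps * c1 / 16 * (y1 + y2) by apply: Rmult_le_compat_r; lra.
  have : c1 / 8 * (eps / 2 * (y1 + y2)) <= c1 / 8 * a by apply: Rmult_le_compat_l; lra.
  by lra.
have az : a * z <= a ^ 2 by nra.
have az0 : 0 <= a * z by nra.
have ap : 0 < a ^ 2 by nra.
have P0 : (l + p1 + p2 + c1) * a ^ 2 <= al * a ^ 2 by apply: Rmult_le_compat_r; lra.
have P1 : p1 * (a * z) <= p1 * a ^ 2 by apply: Rmult_le_compat_l.
have P2 : p2 * (a * z) <= p2 * a ^ 2 by apply: Rmult_le_compat_l.
have P3 : l * z ^ 2 <= l * a ^ 2 by apply: Rmult_le_compat_l.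
have P4 : 2 * w * (y1 + y2) * a <= c1 / 4 * a * a by apply: Rmult_le_compat_r; lra.
have P5 : 2 * w * (y1 + y2) * z <= c1 / 4 * a * z by apply: Rmult_le_compat_r; lra.
have P6 : c1 * (a * z) <= c1 * a ^ 2 by apply: Rmult_le_compat_l; lra.
have P7 : 0 < c1 * a ^ 2 by nra.
split; first by lra.
have Q1 : E * (c1 / 4 * Y + Y') <= E * (c1 / 4 * Y + (l + p2 + 2 * w) * Y).
  by apply: Rmult_le_compat_l; lra.
have Q2 : E * (c1 / 4 * Y + (l + p2 + 2 * w) * Y) = (c1 / 4 + l + p2 + 2 * w) * (E * Y) by ring.
have Q3 : (c1 / 4 + l + p2 + 2 * w) * (E * Y) <= (c1 / 4 + l + p2 + 2 * w) * a ^ 2.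
  by apply: Rmult_le_compat_l; lra.
have Q4 : w * a ^ 2 <= c1 / 16 * a ^ 2 by apply: Rmult_le_compat_r; lra.
by lra.
Qed.

(* Two difference quotients with the same z-displacement v solve, up to a small error, the same
   linear equation; their difference starts in the cone, so it outgrows the quotients themselves
   unless it is small. *)
Lemma quotients_close x0 eps : Gamma x0 -> 0 < eps ->
  exists rho, 0 < rho /\ forall p1 q1 p2 q2 s1 s2 v,
    Gamma p1 -> Gamma q1 -> Gamma p2 -> Gamma q2 -> s1 <> 0 -> s2 <> 0 -> vnorm v <= 1 ->
    vnorm (dz x0 p1) < rho -> vnorm (dz x0 q1) < rho ->
    vnorm (dz x0 p2) < rho -> vnorm (dz x0 q2) < rho ->
    dz p1 q1 = vscal s1 v -> dz p2 q2 = vscal s2 v ->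
    vnorm (vsub (vscal (/ s1) (da p1 q1)) (vscal (/ s2) (da p2 q2))) <= eps.
Proof.
move=> G0 eps0; have [phi Sphi] := Gamma_sol G0.
have [S0 G0'] := Sphi.
(* [E s = C * exp (c * s)] is the ratio that the squared difference must keep over [Y]. As
   [Y 0 <= 4], this [C] gives [C * Y 0 <= eps ^ 2]; and [T] satisfies [C * (1 + c * T) = C + 1], so
   that [E T >= 1]. *)
pose c := c1 / 2.
have c0 : 0 < c by rewrite /c; lra.
pose C := eps ^ 2 / 4.
have C0 : 0 < C by rewrite /C; nra.
pose T := / C / c.
have T0 : 0 <= T by apply/Rlt_le/Rdiv_lt_0_compat => //; exact: Rinv_0_lt_compat.
pose w := Rmin (c1 / 16) (eps * c1 / 16).
have w0 : 0 < w by apply: Rmin_glb_lt; nra.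
have w1 : w <= c1 / 16 by exact: Rmin_l.
have w2 : w <= eps * c1 / 16 by exact: Rmin_r.
have [d [d0 Htube]] := tube T S0 w0.
have [rho [rho0 Hrho]] := stay_in_tube Sphi T0 d0 Htube.
exists rho; split=> // p1 q1 p2 q2 s1 s2 v Gp1 Gq1 Gp2 Gq2 s10 s20 v1 rp1 rq1 rp2 rq2 E1 E2.
apply: Rnot_lt_le => N.
have [P1 SP1] := Gamma_sol Gp1; have [Q1 SQ1] := Gamma_sol Gq1.
have [P2 SP2] := Gamma_sol Gp2; have [Q2 SQ2] := Gamma_sol Gq2.
have tP1 := Hrho _ _ SP1 rp1; have tQ1 := Hrho _ _ SQ1 rq1.
have tP2 := Hrho _ _ SP2 rp2; have tQ2 := Hrho _ _ SQ2 rq2.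
have [[iP1 [fP1 UP1]] GP1] := SP1; have [[iQ1 [fQ1 UQ1]] GQ1] := SQ1.
have [[iP2 [fP2 UP2]] GP2] := SP2; have [[iQ2 [fQ2 UQ2]] GQ2] := SQ2.
pose u1a s := vscal (/ s1) (da (P1 s) (Q1 s)).
pose u1z s := vscal (/ s1) (dz (P1 s) (Q1 s)).
pose u2a s := vscal (/ s2) (da (P2 s) (Q2 s)).
pose u2z s := vscal (/ s2) (dz (P2 s) (Q2 s)).
pose u1a' s := vscal (/ s1) (vsub (f (Q1 s)) (f (P1 s))).
pose u1z' s := vscal (/ s1) (vsub (g (Q1 s)) (g (P1 s))).
pose u2a' s := vscal (/ s2) (vsub (f (Q2 s)) (f (P2 s))).
pose u2z' s := vscal (/ s2) (vsub (g (Q2 s)) (g (P2 s))).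
have du1a s i : 0 <= s -> derivable_pt_lim (fun r => u1a r i) s (u1a' s i).
  move=> Hs; apply: derivable_pt_lim_scal; apply: derivable_pt_lim_minus.
    exact: (fQ1 s Hs).1.
  exact: (fP1 s Hs).1.
have du1z s i : 0 <= s -> derivable_pt_lim (fun r => u1z r i) s (u1z' s i).
  move=> Hs; apply: derivable_pt_lim_scal; apply: derivable_pt_lim_minus.
    exact: (fQ1 s Hs).2.
  exact: (fP1 s Hs).2.
have du2a s i : 0 <= s -> derivable_pt_lim (fun r => u2a r i) s (u2a' s i).
  move=> Hs; apply: derivable_pt_lim_scal; apply: derivable_pt_lim_minus.
    exact: (fQ2 s Hs).1.
  exact: (fP2 s Hs).1.
have du2z s i : 0 <= s -> derivable_pt_lim (fun r => u2z r i) s (u2z' s i).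
  move=> Hs; apply: derivable_pt_lim_scal; apply: derivable_pt_lim_minus.
    exact: (fQ2 s Hs).2.
  exact: (fP2 s Hs).2.
pose ea s := vsub (u1a s) (u2a s); pose ez s := vsub (u1z s) (u2z s).
pose D s := dot (ea s) (ea s); pose Z s := dot (ez s) (ez s).
pose D' s := 2 * dot (ea s) (vsub (u1a' s) (u2a' s)).
pose Z' s := 2 * dot (ez s) (vsub (u1z' s) (u2z' s)).
pose Y s := 2 * (dot (u1z s) (u1z s) + dot (u2z s) (u2z s)).
pose Y' s := 2 * (2 * dot (u1z s) (u1z' s) + 2 * dot (u2z s) (u2z' s)).
pose E s := C * exp (c * s).
have iv k (b : R) (u : vec k) : b <> 0 -> vscal (/ b) (vscal b u) = u.
  by move=> b0; vext; field.
have i1 : u1z 0 = v by rewrite /u1z iP1 iQ1 E1 iv.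
have i2 : u2z 0 = v by rewrite /u2z iP2 iQ2 E2 iv.
have Z0 : Z 0 = 0.
  by rewrite /Z /ez i1 i2 -vnorm2 vnorm_subvv; ring.
have v0 := vnorm_ge0 v.
have Y0 : Y 0 <= 4 by rewrite /Y i1 i2 -!vnorm2; nra.
have D0 : eps ^ 2 < D 0.
  rewrite /D /ea /u1a /u2a iP1 iQ1 iP2 iQ2 -vnorm2.
  by set r := vnorm _ in N *; nra.
(* A positive slack carried along: it keeps the difference nonzero and makes the final contradiction
   strict. *)
pose k := D 0 - C * Y 0.
have k0 : 0 < k.
  have : C * Y 0 <= eps ^ 2 by rewrite /C; nra.
  by rewrite /k; lra.
have dE s : derivable_pt_lim E s (c * E s).
  have := derivable_pt_lim_scal _ C _ _ (derivable_pt_lim_comp _ exp _ _ _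
    (derivable_pt_lim_scal _ c s _ (derivable_pt_lim_id s)) (derivable_pt_lim_exp _)).
  apply: derivable_pt_lim_eq => [r|]; rewrite /Ranalysis1.comp /mult_real_fct /Ranalysis1.id //.
  by rewrite /E; ring.
have E_ge s : 0 <= s -> C * (1 + c * s) <= E s.
  move=> Hs; apply: Rmult_le_compat_l; first lra.
  exact: exp_ineq1_le.
have [] := @barrier (fun s => D s - Z s) (fun s => D s - E s * Y s - k)
  (fun s => D' s - Z' s) (fun s => D' s - (c * E s * Y s + E s * Y' s)) T _ _ _ _ T;
  last 1 first.
(* At time [T], [E T >= 1] would give [D T >= Y T + k]. But each quotient has its [a]-part bounded
   by its [z]-part, so [D T <= (y1 + y2) ^ 2 <= Y T]. *)
- move=> _ V2.
  have [L1 _] := scaled_linearization (Rlt_le _ _ w0) (GP1 T T0) (GQ1 T T0) s10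
    (fun y => Htube T y (conj T0 (Rle_refl T))) (tP1 T (conj T0 (Rle_refl T)))
    (tQ1 T (conj T0 (Rle_refl T))).
  have [L2 _] := scaled_linearization (Rlt_le _ _ w0) (GP2 T T0) (GQ2 T T0) s20
    (fun y => Htube T y (conj T0 (Rle_refl T))) (tP2 T (conj T0 (Rle_refl T)))
    (tQ2 T (conj T0 (Rle_refl T))).
  move: L1 L2; rewrite -/(u1a T) -/(u2a T) -/(u1z T) -/(u2z T) => L1 L2.
  have tri := vnorm_sub (u1a T) (u2a T); rewrite -/(ea T) in tri.
  have E1T : 1 <= E T.
    have := E_ge T T0; rewrite (_ : C * (1 + c * T) = C + 1); first lra.
    by rewrite /T; field; lra.
  move: V2; rewrite /D /Y -!vnorm2.
  have a1 := vnorm_ge0 (ea T).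
  move: L1 L2 tri a1 (vnorm_ge0 (u1a T)) (vnorm_ge0 (u2a T)) (vnorm_ge0 (u1z T)) (vnorm_ge0 (u2z T)).
  set a := vnorm (ea T); set b1 := vnorm (u1a T); set b2 := vnorm (u2a T).
  set y1 := vnorm _; set y2 := vnorm _ => L1 L2 tri a1 ? ? ? ? V2.
  have A : a ^ 2 <= 2 * (y1 ^ 2 + y2 ^ 2).
    have : a ^ 2 <= (y1 + y2) ^ 2 by apply: pow_incr; lra.
    by have := pow2_ge_0 (y1 - y2); lra.
  have : 2 * (y1 ^ 2 + y2 ^ 2) <= E T * (2 * (y1 ^ 2 + y2 ^ 2)) by nra.
  by lra.
- move=> s [Hs _].
  have dD : derivable_pt_lim D s (D' s).
    by apply: derivable_pt_lim_sqnorm => i; apply: derivable_pt_lim_minus; auto.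
  have dZ : derivable_pt_lim Z s (Z' s).
    by apply: derivable_pt_lim_sqnorm => i; apply: derivable_pt_lim_minus; auto.
  have dY : derivable_pt_lim Y s (Y' s).
    apply: derivable_pt_lim_scal; apply: derivable_pt_lim_plus;
      by apply: derivable_pt_lim_sqnorm => i; auto.
  split; first exact: derivable_pt_lim_minus.
  have := derivable_pt_lim_minus _ _ _ _ _ (derivable_pt_lim_minus _ _ _ _ _ dD
    (derivable_pt_lim_mult _ _ _ _ _ (dE s) dY)) (derivable_pt_lim_const k s).
  by apply: derivable_pt_lim_eq => [r|] //; rewrite Rminus_0_r.
- by rewrite Z0; nra.
- have -> : E 0 = C by rewrite /E Rmult_0_r exp_0; ring.
  by rewrite /k; lra.
- move=> s Hs V1 V2; have s0 := Hs.1.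
  have [L1 [r1a [r1z [F1 [F2 [F3 F4]]]]]] := scaled_linearization (Rlt_le _ _ w0)
    (GP1 s s0) (GQ1 s s0) s10 (fun y => Htube s y Hs) (tP1 s Hs) (tQ1 s Hs).
  have [L2 [r2a [r2z [H1 [H2 [H3 H4]]]]]] := scaled_linearization (Rlt_le _ _ w0)
    (GP2 s s0) (GQ2 s s0) s20 (fun y => Htube s y Hs) (tP2 s Hs) (tQ2 s Hs).
  rewrite -/(u1a s) -/(u1z s) in L1 F1 F2 F3 F4.
  rewrite -/(u2a s) -/(u2z s) in L2 H1 H2 H3 H4.
  rewrite -/(u1a' s) in F1; rewrite -/(u1z' s) in F2.
  rewrite -/(u2a' s) in H1; rewrite -/(u2z' s) in H2.
  have U0 := S0.2.2 s s0.
  have [A0 [l0 [HA [HL AL]]]] := Hbounds U0.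
  have b1 := opnorm_ge0 (Dzf (phi s)); have b2 := opnorm_ge0 (Dag (phi s)).
  have y10 := vnorm_ge0 (u1z s); have y20 := vnorm_ge0 (u2z s).
  have a0 := vnorm_ge0 (ea s); have z0 := vnorm_ge0 (ez s).
  have CE : C <= E s.
    have cs : 0 <= c * s by apply: Rmult_le_pos; lra.
    by have := E_ge s s0; nra.
  have Y00 : 0 <= Y s by rewrite /Y -!vnorm2; nra.
  have EY0 : 0 <= E s * Y s by apply: Rmult_le_pos; lra.
  have DD : D s = vnorm (ea s) ^ 2 by rewrite /D vnorm2.
  have ZZ : Z s = vnorm (ez s) ^ 2 by rewrite /Z vnorm2.
  have ap : 0 < vnorm (ea s) by rewrite DD in V2; nra.
  have YY : Y s = 2 * (vnorm (u1z s) ^ 2 + vnorm (u2z s) ^ 2) by rewrite /Y !vnorm2.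
  have half r : 2 * r / 2 = r by field.
  have [] := @difference_growth (alpha (phi s)) (opnorm (Dzf (phi s))) (opnorm (Dag (phi s)))
    (ell (phi s)) w eps (vnorm (u1z s)) (vnorm (u2z s)) (vnorm (ea s)) (vnorm (ez s)) (Y s)
    (D' s / 2) (Z' s / 2) (Y' s / 2) (E s); rewrite -?DD -?ZZ //; try lra.
  + rewrite DD /D' half.
    have -> : vsub (u1a' s) (u2a' s) = vadd (vadd (mapply (Daf (phi s)) (ea s))
        (mapply (Dzf (phi s)) (ez s))) (vsub r1a r2a).
      by rewrite F1 H1 /ea /ez !mapplyB; vext.
    rewrite dotDr dotDr.
    have I1 := HA (ea s).
    have I2 := dot_mapply_ge (Dzf (phi s)) (ea s) (ez s).
    have I3 := dot_ge (ea s) (vsub r1a r2a).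
    have I4 := vnorm_sub r1a r2a.
    have I5 : vnorm (ea s) * vnorm (vsub r1a r2a)
      <= vnorm (ea s) * (2 * w * (vnorm (u1z s) + vnorm (u2z s))).
      by apply: Rmult_le_compat_l; lra.
    by lra.
  + rewrite ZZ /Z' half.
    have -> : vsub (u1z' s) (u2z' s) = vadd (vadd (mapply (Dag (phi s)) (ea s))
        (mapply (Dzg (phi s)) (ez s))) (vsub r1z r2z).
      by rewrite F2 H2 /ea /ez !mapplyB; vext.
    rewrite dotDr dotDr.
    have I1 := HL (ez s).
    have I2 := dot_mapply_le (Dag (phi s)) (ez s) (ea s).
    have I3 := dot_le (ez s) (vsub r1z r2z).
    have I4 := vnorm_sub r1z r2z.
    have I5 : vnorm (ez s) * vnorm (vsub r1z r2z)
      <= vnorm (ez s) * (2 * w * (vnorm (u1z s) + vnorm (u2z s))).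
      by apply: Rmult_le_compat_l; lra.
    by lra.
  (* For a single quotient the bound [|ua| <= |uz|] turns the coupling term into growth of [uz], at
     rate at most [ell] plus the norm of [Dag] plus [2 * w]. *)
  + have B (ua : vec n) (uz uz' rz : vec m) : vnorm ua <= vnorm uz ->
        uz' = vadd (vadd (mapply (Dag (phi s)) ua) (mapply (Dzg (phi s)) uz)) rz ->
        vnorm rz <= 2 * w * vnorm uz ->
        dot uz uz' <= (ell (phi s) + opnorm (Dag (phi s)) + 2 * w) * vnorm uz ^ 2.
      move=> L -> R; rewrite !dotDr.
      have I1 := HL uz.
      have I2 := dot_mapply_le (Dag (phi s)) uz ua.
      have I3 := dot_le uz rz.
      have n0 := vnorm_ge0 uz.
      have I4 : vnorm uz * vnorm rz <= vnorm uz * (2 * w * vnorm uz) by apply: Rmult_le_compat_l.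
      have I5 : opnorm (Dag (phi s)) * vnorm uz * vnorm ua <= opnorm (Dag (phi s)) * vnorm uz * vnorm uz.
        by apply: Rmult_le_compat_l => //; apply: Rmult_le_pos.
      by lra.
    have := B _ _ _ _ L1 F2 F4; have := B _ _ _ _ L2 H2 H4.
    by rewrite /Y' /Y -!vnorm2; lra.
  + by rewrite /c; lra.
- by lra.
Qed.

(** * The graph function and its derivative *)

Hypothesis HGproj : forall z : vec m,
  (exists x, Gamma x /\ Piperp x = z) <-> (exists x, U x /\ Piperp x = z).

Definition K (z : vec m) := exists x, Gamma x /\ Piperp x = z.
(** A total function by choice, arbitrary off [K]; on [K] the value is unique by [Gamma_sep]. *)
Definition h (z : vec m) : vec n := epsilon (inhabits (fun=> 0)) (fun a => Gamma (a, z)).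

Lemma graph_mem z : K z -> Gamma (h z, z).
Proof.
move=> [[a z'] [Gx <-]].
by apply: (epsilon_spec _ (fun a => Gamma (a, z'))); exists a.
Qed.

(** Some [y] of [Gamma] lies over the same [z] as [x]. Both have global solutions in [U], so if
    distinct they would be strictly separated by a zero [z]-difference. *)
Lemma Gamma_maximal S : pos_invariant f g U S -> forall x, S x -> Gamma x.
Proof.
move=> [SU HS] x Sx; have Ux := SU x Sx.
have [y [Gy yx]] : K x.2 by apply/HGproj; exists x.
have [<-//|xy] := excluded_middle_informative (y = x).
have [phi [i0 [i1 [i2 _]]]] := HS x Sx; have [psi [Spsi _]] := Gamma_sol Gy.
have := cone_sep Spsi (conj i0 (conj i1 i2)) xy.
rewrite /dz (_ : y.2 = x.2) // vnorm_subvv.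
by have := vnorm_ge0 (da y x); lra.
Qed.

Lemma Gamma_graph x : Gamma x <-> exists z, K z /\ x = (h z, z).
Proof.
split=> [Gx|[z [Kz ->]]]; last exact: graph_mem.
have Kx : K x.2 by exists x.
exists x.2; split=> //; apply: NNPP => xy.
have := Gamma_sep Gx (graph_mem Kx) xy.
rewrite /dz /= vnorm_subvv.
by have := vnorm_ge0 (da x (h x.2, x.2)); lra.
Qed.

(** Openness of [U] allows [z] to move with [h z] fixed, and [U] and [Gamma] have the same
    projection. *)
Lemma K_open z : K z -> exists r, 0 < r /\ forall w, vnorm (vsub w z) < r -> K w.
Proof.
move=> Kz; have Uz := HGinv.1 _ (graph_mem Kz).
have [r [r0 Hr]] := HUopen Uz.
exists r; split=> // w wr; apply/HGproj; exists (h z, w); split=> //.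
apply: Hr; apply: Rle_lt_trans (Xnorm_le_add _) _ => /=.
by rewrite vnorm_subvv; lra.
Qed.

(** * Strict differentiability of the graph function *)

Definition basis (j : 'I_m) : vec m := fun i => if i == j then 1 else 0.

Lemma vnorm_basis j : vnorm (basis j) <= 1.
Proof.
apply: vnorm_le; first lra.
rewrite /dot (bigD1 j) //= big1 /basis ?eqxx => [|i /negbTE ->]; last ring.
by rewrite /=; lra.
Qed.

Lemma mapply_basis (A : mat n m) j : mapply A (basis j) = fun i => A i j.
Proof.
apply: functional_extensionality => i.
rewrite /mapply (bigD1 j) //= big1 /basis ?eqxx => [|k /negbTE ->]; last ring.
by rewrite /=; ring.
Qed.

(** The base point [p] varies along with the step [s]; this is what leads to strict derivatives. *)
Definition quot j p s := vscal (/ s) (vsub (h (vadd p (vscal s (basis j)))) (h p)).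

Lemma quot_cauchy z j eps : K z -> 0 < eps ->
  exists rho, 0 < rho /\ forall p1 s1 p2 s2, s1 <> 0 -> s2 <> 0 ->
    vnorm (vsub p1 z) < rho -> vnorm (vsub (vadd p1 (vscal s1 (basis j))) z) < rho ->
    vnorm (vsub p2 z) < rho -> vnorm (vsub (vadd p2 (vscal s2 (basis j))) z) < rho ->
    vnorm (vsub (quot j p1 s1) (quot j p2 s2)) <= eps.
Proof.
move=> Kz eps0; have [r [r0 Hr]] := K_open Kz.
have [rho [rho0 Hrho]] := quotients_close (graph_mem Kz) eps0.
exists (Rmin r rho); split; first exact: Rmin_glb_lt.
have ml := Rmin_l r rho; have mr := Rmin_r r rho.
move=> p1 s1 p2 s2 s10 s20 B1 B2 B3 B4.
have G w : vnorm (vsub w z) < Rmin r rho -> Gamma (h w, w) by move=> ?; apply/graph_mem/Hr; lra.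
have L w : vnorm (vsub w z) < Rmin r rho -> vnorm (dz (h z, z) (h w, w)) < rho.
  by rewrite /dz /=; lra.
have dzE p s : dz (h p, p) (h (vadd p (vscal s (basis j))), vadd p (vscal s (basis j)))
  = vscal s (basis j) by rewrite /dz /=; vext.
exact: Hrho (G _ B1) (G _ B2) (G _ B3) (G _ B4) s10 s20 (vnorm_basis j)
  (L _ B1) (L _ B2) (L _ B3) (L _ B4) (dzE _ _) (dzE _ _).
Qed.

(** The limit is taken coordinatewise along the steps [1 / (k + 1)] based at [z]. The Cauchy
    estimate, uniform in base point and step, then compares every other quotient with it. *)
Lemma strict_partial z j : K z -> exists A : vec n, forall eps, 0 < eps ->
  exists rho, 0 < rho /\ forall p s, s <> 0 ->
    vnorm (vsub p z) < rho -> vnorm (vsub (vadd p (vscal s (basis j))) z) < rho ->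
    vnorm (vsub (quot j p s) A) <= eps.
Proof.
move=> Kz.
have s0 k : RinvN k <> 0 :> R by have := RinvN_pos k; rewrite /=; lra.
have small rho : 0 < rho -> exists N, forall k, (k >= N)%coq_nat ->
    vnorm (vsub (vadd z (vscal (RinvN k) (basis j))) z) < rho.
  move=> rho0; have [N HN] := RinvN_cv rho0; exists N => k /HN.
  rewrite /Rdist Rminus_0_r => H.
  have -> : vsub (vadd z (vscal (RinvN k) (basis j))) z = vscal (RinvN k) (basis j) by vext.
  rewrite vnormZ; have := vnorm_basis j; have := vnorm_ge0 (basis j).
  by have := Rabs_pos (RinvN k); nra.
have cz rho : 0 < rho -> vnorm (vsub z z) < rho by rewrite vnorm_subvv.
have lim i : { l : R | Un_cv (fun k => quot j z (RinvN k) i) l }.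
  apply: R_complete => eps eps0.
  have e2 : 0 < eps / 2 by lra.
  have [rho [rho0 Hrho]] := quot_cauchy j Kz e2.
  have [N HN] := small _ rho0.
  exists N => k l kN lN.
  have := Hrho z _ z _ (s0 k) (s0 l) (cz _ rho0) (HN _ kN) (cz _ rho0) (HN _ lN).
  have := coord_le_vnorm (vsub (quot j z (RinvN k)) (quot j z (RinvN l))) i.
  by rewrite /Rdist /vsub; lra.
exists (fun i => sval (lim i)) => eps eps0.
have n0 := pos_INR n.
(* Each coordinate errs by at most [2 * e]: once from the Cauchy estimate, once from the limit. *)
have e0 : 0 < eps / (2 * (INR n + 1)) by apply: Rdiv_lt_0_compat; lra.
set e := eps / _ in e0.
have [rho [rho0 Hrho]] := quot_cauchy j Kz e0.
exists rho; split=> // p s sn0 B1 B2.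
apply: Rle_trans (vnorm_le_coord (r := 2 * e) _ _) _; first lra.
- move=> i; rewrite {1}/vsub; case: (lim i) => l Hl; rewrite [sval _]/=.
  have [N1 HN1] := Hl e e0; have [N2 HN2] := small _ rho0.
  pose k := Nat.max N1 N2.
  have k1 := HN1 k (PeanoNat.Nat.le_max_l _ _); have k2 := HN2 k (PeanoNat.Nat.le_max_r _ _).
  have := Hrho p s z _ sn0 (s0 k) B1 B2 (cz _ rho0) k2.
  have := coord_le_vnorm (vsub (quot j p s) (quot j z (RinvN k))) i.
  move: k1; rewrite /Rdist /vsub => k1 I1 I2.
  have -> : quot j p s i - l
    = (quot j p s i - quot j z (RinvN k) i) + (quot j z (RinvN k) i - l) by ring.
  by apply: Rle_trans (Rabs_triang _ _) _; lra.
- have -> : eps = (INR n + 1) * (2 * e) by rewrite /e; field; lra.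
  by apply: Rmult_le_compat_r; lra.
Qed.

(** Both points are free: [p = z] gives the Fréchet derivative, and [p] near [z] gives continuity of
    the derivative. *)
Definition strict_derivative (z : vec m) (A : mat n m) := forall eps, 0 < eps ->
  exists rho, 0 < rho /\ forall p q, vnorm (vsub p z) < rho -> vnorm (vsub q z) < rho ->
    vnorm (fun i => h q i - h p i - mapply A (vsub q p) i) <= eps * vnorm (vsub q p).

(** A path from [p] to [q] that changes one coordinate at a time. *)
Definition mix (p q : vec m) (k : nat) : vec m := fun i => if (i < k)%N then q i else p i.

(** Every coordinate comes from [p] or [q], so the squared distance to [z] is at most the sum of
    theirs. *)
Lemma mix_ball p q z k rho : 0 < rho -> vnorm (vsub p z) < rho / 2 -> vnorm (vsub q z) < rho / 2 ->
  vnorm (vsub (mix p q k) z) < rho.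
Proof.
move=> rho0 Hp Hq; apply: vnorm_lt => //.
apply: Rle_lt_trans (_ : dot (vsub p z) (vsub p z) + dot (vsub q z) (vsub q z) < _).
  rewrite /dot -big_split /=; apply: sumr_le => i.
  have := Rle_0_sqr (p i - z i); have := Rle_0_sqr (q i - z i).
  by rewrite /Rsqr /vsub /mix; case: ifP => _; move=> /=; lra.
rewrite -!vnorm2.
by have := vnorm_ge0 (vsub p z); have := vnorm_ge0 (vsub q z); nra.
Qed.

Lemma mixS p q (k : 'I_m) :
  mix p q k.+1 = vadd (mix p q k) (vscal (q k - p k) (basis k)).
Proof.
apply: functional_extensionality => i; rewrite /mix /vadd /vscal /basis ltnS.
case: (ltngtP i k) => ik; case: eqP => E; try ring.
- by move: ik; rewrite E ltnn.
- by move: ik; rewrite E ltnn.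
- by rewrite E; ring.
- by case: E; apply: val_inj.
Qed.

(** The increment of [h] telescopes along [mix]: each step is a strict partial quotient, and its
    length is at most [vnorm (vsub q p)]. At most [m] errors [e] add up. *)
Lemma strict_derivative_exists z : K z -> exists A, strict_derivative z A.
Proof.
move=> Kz; pose A i j := sval (constructive_indefinite_description _ (strict_partial j Kz)) i.
exists (fun i j => A i j) => eps eps0.
have m0 := pos_INR m.
have e0 : 0 < eps / (INR m + 1) by apply: Rdiv_lt_0_compat; lra.
set e := eps / _ in e0.
have [rho [rho0 Hrho]] : exists rho, 0 < rho /\ forall j p s, s <> 0 ->
    vnorm (vsub p z) < rho -> vnorm (vsub (vadd p (vscal s (basis j))) z) < rho ->
    vnorm (vsub (quot j p s) (A ^~ j)) <= e.
  apply: (@finite_radius m (fun j rho => forall p s, s <> 0 ->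
    vnorm (vsub p z) < rho -> vnorm (vsub (vadd p (vscal s (basis j))) z) < rho ->
    vnorm (vsub (quot j p s) (A ^~ j)) <= e)).
    by move=> j r r' rr' H p s s0 B1 B2; apply: H => //; lra.
  move=> j; rewrite /A.
  by case: (constructive_indefinite_description _ _) => B /= HB; exact: HB.
exists (rho / 2); split; first lra.
move=> p q Hp Hq.
have qp0 := vnorm_ge0 (vsub q p).
have step k : (k <= m)%N ->
    vnorm (fun i => h (mix p q k) i - h p i - mapply A (vsub (mix p q k) p) i)
    <= INR k * e * vnorm (vsub q p).
  elim: k => [_|k IH km].
    have -> : mix p q 0 = p by [].
    have -> : vsub p p = vscal 0 p by vext.
    rewrite mapplyZ (_ : (fun i => _) = vscal 0 (h p)); last by vext.
    by rewrite vnormZ Rabs_R0 /=; lra.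
  have := mixS p q (Ordinal km); set s := q _ - p _ => E; rewrite /= in E.
  (* A coordinate that does not change contributes nothing, and has no difference quotient. *)
  have [s0|s0] := Req_dec s 0.
    have -> : mix p q k.+1 = mix p q k by rewrite E s0; vext.
    apply: Rle_trans (IH (ltnW km)) _.
    by rewrite S_INR; apply: Rmult_le_compat_r => //; nra.
  have := Hrho (Ordinal km) (mix p q k) s s0 (mix_ball _ rho0 Hp Hq).
  rewrite -E => /(_ (mix_ball _ rho0 Hp Hq)) Hs.
  have {}IH := IH (ltnW km).
  set r := (fun i => _) in IH; set d := vsub _ _ in Hs.
  have -> : (fun i => h (mix p q k.+1) i - h p i - mapply A (vsub (mix p q k.+1) p) i)
    = vadd r (vscal s d).
    have -> : vsub (mix p q k.+1) p = vadd (vsub (mix p q k) p) (vscal s (basis (Ordinal km))).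
      by rewrite E; vext.
    rewrite mapplyD mapplyZ mapply_basis /d /quot -E /r; vext.
    by field.
  apply: Rle_trans (vnorm_add _ _) _; rewrite vnormZ.
  have sq : Rabs s <= vnorm (vsub q p) by exact: (coord_le_vnorm (vsub q p) (Ordinal km)).
  have : Rabs s * vnorm d <= vnorm (vsub q p) * e.
    by apply: Rmult_le_compat => //; [exact: Rabs_pos | exact: vnorm_ge0].
  by rewrite S_INR; lra.
have := step m (leqnn m).
have -> : mix p q m = q by apply: functional_extensionality => i; rewrite /mix ltn_ord.
move=> H; apply: Rle_trans H _; apply: Rmult_le_compat_r => //.
have -> : eps = (INR m + 1) * e by rewrite /e; field; lra.
by lra.
Qed.

Definition Dh (z : vec m) : mat n m := epsilon (inhabits (fun _ _ => 0)) (strict_derivative z).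

Lemma Dh_strict z : K z -> strict_derivative z (Dh z).
Proof. by move=> Kz; apply: epsilon_spec; exact: strict_derivative_exists. Qed.

Lemma Dh_frechet z : K z -> frechet h z (Dh z).
Proof.
move=> Kz eps eps0; have [rho [rho0 H]] := Dh_strict Kz eps0.
by exists rho; split=> // w Hw; apply: H; rewrite ?vnorm_subvv.
Qed.

(** The same small increment of [h] from [w] along a basis vector is approximated by both [Dh z] and
    [Dh w], so the corresponding columns nearly agree. *)
Lemma Dh_continuous : mat_cont_on K Dh.
Proof.
move=> i j z Kz eps eps0.
have e0 : 0 < eps / 4 by lra.
have [rho [rho0 Hz]] := Dh_strict Kz e0.
exists (rho / 2); split; first lra.
move=> w Kw wz.
have [r [r0 Hw]] := Dh_strict Kw e0.
pose s := Rmin (rho / 2) r / 2.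
have m0 : 0 < Rmin (rho / 2) r by apply: Rmin_glb_lt; lra.
have ml := Rmin_l (rho / 2) r; have mr := Rmin_r (rho / 2) r.
have s0 : 0 < s by rewrite /s; lra.
pose q := vadd w (vscal s (basis j)).
have qw : vsub q w = vscal s (basis j) by rewrite /q; vext.
have nqw : vnorm (vsub q w) <= s.
  by rewrite qw vnormZ Rabs_pos_eq; [have := vnorm_basis j; nra | lra].
have qz := vnorm_sub_tri q w z.
have I1 := Hz w q ltac:(lra) ltac:(move: ml; rewrite /s in nqw; lra).
have I2 := Hw w q ltac:(rewrite vnorm_subvv; lra) ltac:(rewrite /s in nqw; lra).
have J1 := coord_le_vnorm (fun i => h q i - h w i - mapply (Dh z) (vsub q w) i) i.
have J2 := coord_le_vnorm (fun i => h q i - h w i - mapply (Dh w) (vsub q w) i) i.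
have I3 : eps / 4 * vnorm (vsub q w) <= eps / 4 * s by apply: Rmult_le_compat_l; lra.
have {}J1 := Rle_trans _ _ _ (Rle_trans _ _ _ J1 I1) I3.
have {}J2 := Rle_trans _ _ _ (Rle_trans _ _ _ J2 I2) I3.
move: J1 J2; rewrite qw !mapplyZ !mapply_basis /vscal => J1 J2.
apply: (Rmult_lt_reg_l s) => //.
rewrite -{1}(Rabs_pos_eq s); last lra.
rewrite -Rabs_mult.
have -> : s * (Dh w i j - Dh z i j)
  = (h q i - h w i - s * Dh z i j) - (h q i - h w i - s * Dh w i j) by ring.
apply: Rle_lt_trans (Rabs_triang _ _) _; rewrite Rabs_Ropp.
have : 0 < eps * s by nra.
by lra.
Qed.

(** The strict inequality between values of [h] alone would give only norm at most 1 in the limit;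
    the constant of [local_contraction] keeps it below 1. *)
Lemma Dh_opnorm z : K z -> opnorm (Dh z) < 1.
Proof.
move=> Kz; have [r [r0 Hr]] := K_open Kz.
have [th [rho [[th0 th1] [rho0 Hth]]]] := local_contraction (graph_mem Kz).
suff : opnorm (Dh z) <= th by lra.
apply: opnorm_le => // v; apply: le_epsilon => e e0.
have v0 := vnorm_ge0 v.
have e'0 : 0 < e / (vnorm v + 1) by apply: Rdiv_lt_0_compat; lra.
have [rh [rh0 H]] := Dh_frechet Kz e'0.
pose M := Rmin r (Rmin rho rh).
have M0 : 0 < M by do 2 (apply: Rmin_glb_lt => //).
have M1 : M <= r by exact: Rmin_l.
have M2 : M <= rho by apply: Rle_trans (Rmin_r _ _) (Rmin_l _ _).
have M3 : M <= rh by apply: Rle_trans (Rmin_r _ _) (Rmin_r _ _).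
(* A step short enough for [z + s * v] to lie within all three radii, also when [v] is zero. *)
pose s := M / (vnorm v + 1).
have s0 : 0 < s by apply: Rdiv_lt_0_compat; lra.
have sM : s * vnorm v < M.
  have : s * (vnorm v + 1) = M by rewrite /s; field; lra.
  by lra.
pose w := vadd z (vscal s v).
have wz : vsub w z = vscal s v by rewrite /w; vext.
have nwz : vnorm (vsub w z) = s * vnorm v by rewrite wz vnormZ Rabs_pos_eq; lra.
have Kw : K w by apply: Hr; lra.
have I1 := H w ltac:(lra).
have I2 : vnorm (vsub (h w) (h z)) <= th * vnorm (vsub w z).
  by apply: (Hth _ (graph_mem Kw)); rewrite /dz /=; lra.
set R := (fun i => _) in I1.
have E : mapply (Dh z) (vscal s v) = vsub (vsub (h w) (h z)) R.
  by rewrite /R wz; vext.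
have I3 := vnorm_sub (vsub (h w) (h z)) R.
rewrite -E mapplyZ vnormZ Rabs_pos_eq in I3; last lra.
rewrite nwz in I1 I2.
have I4 : s * vnorm (mapply (Dh z) v) <= s * (th * vnorm v + e / (vnorm v + 1) * vnorm v) by lra.
have {}I4 := Rmult_le_reg_l _ _ _ s0 I4.
have : e / (vnorm v + 1) * (vnorm v + 1) = e by field; lra.
by lra.
Qed.

End Dynamics.

Theorem theorem1p1 (n m : nat)
  (f : X n m -> vec n) (g : X n m -> vec m) (U Gamma : X n m -> Prop)
  (* Hypothesis 1 *)
  (HUopen : openX U) (HUconv : convexX U)
  (HUcone : exists d, 0 < d /\
     forall x, U x -> forall x', cone x x' -> U x' -> boxB d x x')
  (* Hypothesis 2 *)
  (H2 : exists (Daf : X n m -> mat n n) (Dzf : X n m -> mat n m)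
               (Dag : X n m -> mat m n) (Dzg : X n m -> mat m m)
               (alpha ell : X n m -> R) (c1 : R),
     C1X_on U f Daf Dzf /\ C1X_on U g Dag Dzg /\
     contX_on U alpha /\ contX_on U ell /\ 0 < c1 /\
     forall x, U x ->
       0 < alpha x /\ 0 <= ell x /\
       (forall a' : vec n, dot a' (mapply (Daf x) a') >= alpha x * vnorm a' ^ 2) /\
       (forall z' : vec m, dot z' (mapply (Dzg x) z') <= ell x * vnorm z' ^ 2) /\
       alpha x >= ell x + opnorm (Dzf x) + opnorm (Dag x) + c1)
  (* Hypothesis 3 *)
  (HGinv : pos_invariant f g U Gamma)
  (HGproj : forall z : vec m,
     (exists x, Gamma x /\ Piperp x = z) <-> (exists x, U x /\ Piperp x = z)) :
  let K : vec m -> Prop := fun z => exists x, Gamma x /\ Piperp x = z in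
  (forall S : X n m -> Prop, pos_invariant f g U S -> forall x, S x -> Gamma x) /\
  exists (h : vec m -> vec n) (Dh : vec m -> mat n m),
    C1_on K h Dh /\
    (forall x : X n m, Gamma x <-> (exists z, K z /\ x = (h z, z))) /\
    (forall z1 z2, K z1 -> K z2 -> z1 <> z2 ->
       vnorm (vsub (h z2) (h z1)) < vnorm (vsub z2 z1)) /\
    (forall z, K z -> opnorm (Dh z) < 1).
Proof.
move=> K0; have [Daf [Dzf [Dag [Dzg [alpha [ell [c1 [Hf [Hg [Ha [_ [c10 Hb]]]]]]]]]]]] := H2.
split; first exact: (Gamma_maximal HUconv HUcone Hf Hg c10 Hb HGinv HGproj).
exists (h Gamma), (Dh Gamma); split; [split|split; [|split]].
- move=> z; exact: (Dh_frechet HUopen HUconv HUcone Hf Hg Ha c10 Hb HGinv HGproj).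
- exact: (Dh_continuous HUopen HUconv HUcone Hf Hg Ha c10 Hb HGinv HGproj).
- exact: (Gamma_graph HUconv HUcone Hf Hg c10 Hb HGinv).
- move=> z1 z2 K1 K2 z12.
  apply: (Gamma_sep HUconv HUcone Hf Hg c10 Hb HGinv (graph_mem K1) (graph_mem K2)).
  by case.
- move=> z; exact: (Dh_opnorm HUopen HUconv HUcone Hf Hg Ha c10 Hb HGinv HGproj).
Qed.
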